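(* The \textsc{Ranking} algorithm achieves an approximation ratio of at least $0.562$ on triangle-free graphs, at least $0.570$ on graphs that are both triangle-free and pentagon-free (i.e., contain no cycle of length $3$ and no cycle of length $5$), and at least $0.615$ on graphs of odd girth at least $129$. Here, achieving approximation ratio $\alpha$ on a class of graphs means that for every graph $G$ in the class with at least one edge, $\mathbb{E}_{\vec x}[|\textsc{R}(\vec x)|]\ge \alpha\,|M^*(G)|$, where $M^*(G)$ is a maximum matching of $G$.
   Context: All graphs are finite simple undirected. The odd girth of a graph is the length of its shortest odd-length cycle. \textsc{Ranking} on $G=(V,E)$: independently for each $v\in V$ sample a rank $x_v$ uniformly from $[0,1]$, giving $\vec x$; process vertices in increasing order of $x_v$; when $v$ is processed, if $v$ is unmatched and has an unmatched neighbor, match $v$ to its unmatched neighbor with the smallest rank. $\textsc{R}(\vec x)$ denotes the resulting matching. *)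

(* Defs.v *)
From mathcomp Require Import all_boot all_order all_algebra.
From mathcomp Require Import all_classical all_reals all_analysis.

Set Implicit Arguments.
Unset Strict Implicit.
Unset Printing Implicit Defensive.

Import Order.TTheory GRing.Theory Num.Theory.

Local Open Scope classical_set_scope.
Local Open Scope ring_scope.

(* A finite simple undirected graph is a finite type of vertices with a
   symmetric irreflexive adjacency relation. *)
Definition simple_graph (V : finType) (e : rel V) : Prop :=
  symmetric e /\ irreflexive e.

Definition has_edge (V : finType) (e : rel V) : Prop := exists u v, e u v.

(* The size bound excludes the closed walk u - v - u on a single edge, which
   ucycle accepts. *)
Definition graph_cycle (V : finType) (e : rel V) (c : seq V) : Prop :=
  (2 < size c)%N /\ ucycle e c.

Definition cycle_free (k : nat) (V : finType) (e : rel V) : Prop :=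
  ~ exists2 c : seq V, graph_cycle e c & size c = k.

Definition triangle_free (V : finType) (e : rel V) : Prop := cycle_free 3 e.
Definition pentagon_free (V : finType) (e : rel V) : Prop := cycle_free 5 e.

(* +oo when there is no odd cycle, i.e. for bipartite graphs. *)
Definition odd_girth (R : realType) (V : finType) (e : rel V) : \bar R :=
  ereal_inf [set (size c)%:R%:E | c in
             [set c : seq V | graph_cycle e c /\ odd (size c)]].

Definition edge_set (V : finType) (e : rel V) : {set {set V}} :=
  [set [set p.1; p.2]%SET | p : V * V & e p.1 p.2]%SET.

Definition matching (V : finType) (e : rel V) (M : {set {set V}}) : bool :=
  (M \subset edge_set e) && finset.trivIset M.

(* The size of a maximum matching. *)
Definition matching_number (V : finType) (e : rel V) : nat :=
  \max_(M : {set {set V}} | matching e M) #|M|.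

Section Ranking.
Variables (R : realType) (V : finType) (e : rel V) (x : V -> R).

(* Vertices by increasing rank. Ties, which have probability 0 for independent
   uniform ranks, are resolved by the enumeration of V, as sort is stable. *)
Definition rank_order : seq V := sort (fun u v => x u <= x v) (enum V).

(* The current matching M is a set of edges, so v is unmatched when
   v \notin cover M. As rank_order is sorted, the head of the filtered list is
   the unmatched neighbor of smallest rank. *)
Definition ranking_step (M : {set {set V}}) (v : V) : {set {set V}} :=
  if v \in finset.cover M then M else
  if ohead [seq u <- rank_order | e v u && (u \notin finset.cover M)] is Some u
  then ([set v; u] |: M)%SET else M.

Definition ranking : {set {set V}} := foldl ranking_step finset.set0 rank_order.

End Ranking.

Section IidUniform.
Context (d : measure_display) (T : measurableType d) (R : realType).
Variables (P : probability T R) (V : finType) (X : V -> {RV P >-> R}).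

Definition mutually_independent : Prop :=
  forall (J : {set V}) (A : V -> set R), (forall v, measurable (A v)) ->
    P (\bigcap_(v in [set` J]) (X v @^-1` A v)) =
    (\prod_(v in J) P (X v @^-1` A v))%E.

Definition uniform01_distributed : Prop :=
  forall (v : V) (A : set R), measurable A ->
    distribution P (X v) A = uniform_prob (@ltr01 R) A.

Definition iid_uniform01 : Prop :=
  mutually_independent /\ uniform01_distributed.

End IidUniform.

(* The ranks are any independent uniform family on any probability space; the
   expectation depends only on their joint law. *)
Definition ranking_achieves (R : realType) (alpha : R)
    (C : forall V : finType, rel V -> Prop) : Prop :=
  forall (V : finType) (e : rel V),
  simple_graph e -> has_edge e -> C V e ->
  forall (d : measure_display) (T : measurableType d) (P : probability T R)
    (X : V -> {RV P >-> R}), iid_uniform01 X ->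
  ((alpha * (matching_number e)%:R)%:E <=
     'E_P[fun w : T => #|ranking e (fun v => X v w)|%:R])%E.

(* Main.v *)
Require Import Defs.
From mathcomp Require Import all_boot all_order all_algebra.
From mathcomp Require Import zify ring lra.
From mathcomp Require Import all_classical all_reals all_analysis.
From mathcomp Require Import measurable_realfun.
From mathcomp Require Import fintype finset.

Set Implicit Arguments.
Unset Strict Implicit.
Unset Printing Implicit Defensive.

Import Order.TTheory GRing.Theory Num.Theory.

(* RANKING returns the unique stable matching of the graph when every vertex
   prefers neighbors of smaller rank, so the effect of adding a vertex u is an
   alternating path along which ranks increase.  Ranks are discretised to
   {0,...,N-1} with N tending to infinity.  For a profile G with G(N) = 1, a
   matched vertex v with mate w receives the gain 1 + G(rank v) - G(rank w), so
   that the gains add up to twice the size of the matching, and it suffices to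
   bound the average gain of the two ends u, w of an edge of a maximum matching.

   Triangle-free graphs, G(s) = (1 + 2 s^3)/3: fix all ranks except x, y of u
   and w, and let P_t, Q_t be the sets of x, y for which u, w would be accepted
   by a neighbor of rank below t in the graph without u and w.  If w fails to
   get a partner of rank below t although y is in Q_t, then, there being no
   triangle on uw, u starts an alternating path ending at w; such paths meet
   every threshold at most once, which confines the failures to a region of
   area at most ab - a^2/2, where a <= b are the sizes of P_t and Q_t.
   Optimising over a and b level by level gives at least 1.141 per edge.

   Odd girth at least 129, G(s) = (4 + 4s + 2s^2 + s^3)/11: since G' >= G, the
   classical bipartite argument works up to the losses of vertices z that are
   made worse by the presence of their own partner u.  Such a z is joined to u
   by an alternating path, which closes to an odd cycle and hence contains at
   least 64 matched vertices before z.  The next vertex on such a path is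
   determined by the matching alone, so the paths of different z are disjoint
   and the total loss is at most 7/11 * 1/64 of the matched vertices. *)

(** * Stable matchings and vertex insertion *)

Section Stable.
Variable V : finType.
Implicit Types (e : rel V) (rho : V -> nat) (M : nat) (f : V -> V) (u v w : V).

(** A matching is encoded as an involution whose fixed points are the unmatched vertices. Being
    unmatched counts as a partner of rank [M], worse than every real one. *)
Definition partner_rank rho M f v := if f v == v then M else rho (f v).

Record stable e rho M f : Prop := Stable {
  stable_inv : involutive f;
  stable_edge : forall v, f v != v -> e v (f v);
  stable_block : forall v w, e v w ->
    (partner_rank rho M f v <= rho w) || (partner_rank rho M f w <= rho v) }.

Definition del u e : rel V := fun v w => [&& e v w, v != u & w != u].

Lemma stable_ext e1 e2 rho M f : e1 =2 e2 -> stable e1 rho M f -> stable e2 rho M f.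
Proof.
move=> E [i ed bl]; split=> //.
- by move=> v /ed; rewrite E.
- by move=> v w; rewrite -E; apply: bl.
Qed.

Lemma del_comm u v e : del u (del v e) =2 del v (del u e).
Proof. by move=> a b; rewrite /del; do !case: (_ == _); rewrite ?andbF ?andbT. Qed.

Lemma del_sym u e : symmetric e -> symmetric (del u e).
Proof. by move=> s a b; rewrite /del s [(a != u) && _]andbC. Qed.

Section Rank.
Variables (rho : V -> nat) (M : nat).
Hypotheses (rho_inj : injective rho) (rho_lt : forall v, rho v < M).
Local Notation prk := (partner_rank rho M).

Lemma prk_le f v : prk f v <= M.
Proof. by rewrite /partner_rank; case: ifP => // _; apply: ltnW. Qed.

Lemma prk_matched f v : (prk f v < M) = (f v != v).
Proof. by rewrite /partner_rank; case: ifP => //=; rewrite ?ltnn // rho_lt. Qed.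

Lemma prk_mate f v : f v != v -> prk f v = rho (f v).
Proof. by rewrite /partner_rank => /negbTE ->. Qed.

Lemma prk_inj f f' v : prk f v = prk f' v -> f v = f' v.
Proof.
rewrite /partner_rank; case: ifP => [/eqP ->|_]; case: ifP => [/eqP -> //|_].
- by move=> E; have := rho_lt (f' v); rewrite -E ltnn.
- by move=> E; have := rho_lt (f v); rewrite E ltnn.
- by move/rho_inj.
Qed.

Lemma prk_rho f v w : prk f v = rho w -> f v = w.
Proof.
rewrite /partner_rank; case: ifP => [_ E|_ /rho_inj //].
by have := rho_lt w; rewrite -E ltnn.
Qed.

Lemma prk_eq f f' v : f v = f' v -> prk f v = prk f' v.
Proof. by rewrite /partner_rank => ->. Qed.

Lemma mate_neq f v : involutive f -> f v != v -> f (f v) != f v.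
Proof. by move=> i; rewrite i eq_sym. Qed.

(** Otherwise [v] and [f v] would block [g]; in the case of equality they would also be mates in
    [g], against the strict preference of [v]. *)
Lemma stable_better e f g v : symmetric e -> stable e rho M f -> stable e rho M g ->
  prk f v < prk g v -> prk g (f v) < prk f (f v).
Proof.
move=> es [fi fe fb] [gi ge gb] lt.
have m : f v != v by rewrite -prk_matched (leq_trans lt) // prk_le.
have m' : f (f v) != f v by apply: mate_neq.
have E : prk f (f v) = rho v by rewrite prk_mate // fi.
have := gb _ _ (fe _ m); rewrite leqNgt -(prk_mate m) lt /= -E leq_eqVlt => /orP[/eqP|//].
rewrite E => /prk_rho gE; move: lt.
by rewrite (@prk_eq f g v) ?ltnn // -{2}gE gi.
Qed.

(** Infinite descent on ranks: if [v] strictly prefers [h] to [k], then [h v] strictly prefers [k],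
    so [k (h v)] again strictly prefers [h], and its rank is smaller than that of [v]. *)
Lemma stable_uniq e f g : symmetric e -> stable e rho M f -> stable e rho M g -> f =1 g.
Proof.
move=> es sf sg.
have key : forall n v h k, rho v < n -> stable e rho M h -> stable e rho M k ->
    ~ prk h v < prk k v.
  elim=> // n IH v h k; rewrite ltnS => vn sh sk lt.
  have lt2 := stable_better es sh sk lt.
  have lt3 := stable_better es sk sh lt2.
  have m : h v != v by rewrite -prk_matched (leq_trans lt) // prk_le.
  have m2 : k (h v) != h v by rewrite -prk_matched (leq_trans lt2) // prk_le.
  apply: (IH (k (h v)) h k) => //.
  rewrite -(prk_mate m2) (leq_trans lt2) // (leq_trans _ vn) //.
  by rewrite prk_mate ?(stable_inv sh) // eq_sym.
move=> v; apply: prk_inj; apply/eqP; rewrite eqn_leq.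
by apply/andP; split; rewrite leqNgt; apply/negP; apply: (key (rho v).+1).
Qed.

(** * The alternating path created by inserting a vertex *)

Section Insertion.
Variables (e : rel V) (u : V) (f f' : V -> V).

Hypotheses (sf : stable (del u e) rho M f) (sf' : stable e rho M f').

Let fi := stable_inv sf.
Let fi' := stable_inv sf'.

(** The path runs [u], [f' u], [f (f' u)], and so on: chain vertices, starting with [u], alternate
    with improved ones. The vertex [u] is kept out of [improved] although its own partner rank may
    drop. *)
Definition improved v := (v != u) && (prk f' v < prk f v).
Definition worsened v := prk f v < prk f' v.
Definition chain v := (v == u) || worsened v.

Lemma ins_fu : f u = u.
Proof. by apply/eqP; apply: contraT => /(stable_edge sf); rewrite /del eqxx /= andbF. Qed.

Lemma worsened_neq v : worsened v -> v != u.
Proof.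
by apply: contraTneq => ->; rewrite /worsened {1}/partner_rank ins_fu eqxx -leqNgt prk_le.
Qed.

(** If the new mate were neither [u] nor worsened, the edge to it would exist without [u] and block
    [f]. The companion [worsened_mate] is the same argument with the two matchings exchanged. *)
Lemma improved_mate v : improved v -> [/\ f' v != v, chain (f' v) & rho (f' v) = prk f' v].
Proof.
move=> /andP[vu lt].
have m : f' v != v by rewrite -prk_matched (leq_trans lt) // prk_le.
split=> //; last by rewrite prk_mate.
rewrite /chain; case: eqVneq => //= wu.
have ed : del u e v (f' v) by rewrite /del (stable_edge sf' m) vu wu.
have E : prk f' (f' v) = rho v by rewrite prk_mate ?fi' // eq_sym.
have := stable_block sf ed; rewrite leqNgt -(prk_mate m) lt /= -E leq_eqVlt => /orP[/eqP|//].
rewrite E => /prk_rho gE; move: lt.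
by rewrite (@prk_eq f' f v) ?ltnn // -{2}gE fi.
Qed.

Lemma worsened_mate v : worsened v -> [/\ f v != v, improved (f v) & rho (f v) = prk f v].
Proof.
move=> wv; have vu := worsened_neq wv; have lt : prk f v < prk f' v := wv.
have m : f v != v by rewrite -prk_matched (leq_trans lt) // prk_le.
have ed := stable_edge sf m.
have /and3P[ed' _ wu] := ed.
split=> //; last by rewrite prk_mate.
rewrite /improved wu /=.
have E : prk f (f v) = rho v by rewrite prk_mate ?fi // eq_sym.
have := stable_block sf' ed'; rewrite leqNgt -(prk_mate m) lt /= -E leq_eqVlt => /orP[/eqP|//].
rewrite E => /prk_rho gE; move: lt.
by rewrite (@prk_eq f f' v) ?ltnn // -{2}gE fi'.
Qed.

Lemma chain_pred v : worsened v -> chain (f' (f v)) /\ rho (f' (f v)) < rho v.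
Proof.
move=> wv; have [m iw _] := worsened_mate wv.
have [m' c E] := improved_mate iw; split=> //.
rewrite E; have /andP[_] := iw.
by rewrite [prk f _]prk_mate ?fi // eq_sym.
Qed.

Lemma improved_pred w : improved w -> f' w != u ->
  improved (f (f' w)) /\ rho (f (f' w)) < rho w.
Proof.
move=> iw wu; have [m + _] := improved_mate iw; rewrite /chain (negbTE wu) /= => wv.
have [m' i E] := worsened_mate wv; split=> //.
rewrite E; have := wv; rewrite /worsened.
by rewrite [prk f' _]prk_mate ?fi' // eq_sym.
Qed.

(** Each step back along the path lowers the rank, so the walk back must stop, and it can only stop
    at the mate of [u]. *)
Lemma improved_head w : improved w -> improved (f' u) /\ rho (f' u) <= rho w.
Proof.
have [n] := ubnP (rho w); elim: n w => // n IH w; rewrite ltnS => wn iw.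
case: (eqVneq (f' w) u) => [E|wu]; first by rewrite -E fi'.
have [i lt] := improved_pred iw wu.
have [|? le] := IH (f (f' w)) _ i; first exact: leq_trans lt wn.
by split=> //; apply: leq_trans le (ltnW lt).
Qed.

Lemma worsened_head v : worsened v -> rho u < rho v.
Proof.
have [n] := ubnP (rho v); elim: n v => // n IH v; rewrite ltnS => vn wv.
have [/orP[/eqP E|w] lt] := chain_pred wv; first by rewrite -E.
by apply: (ltn_trans _ lt); apply: IH => //; exact: leq_trans lt vn.
Qed.

Lemma head_improved : f' u != u -> improved (f' u).
Proof.
move=> m; rewrite /improved m /=.
have E : prk f' (f' u) = rho u by rewrite prk_mate ?fi' // eq_sym.
case: (ltngtP (prk f' (f' u)) (prk f (f' u))) => // [lt|].
  have [_ i _] := worsened_mate lt.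
  by have [/andP[_ lt2] _] := improved_head i; move: lt2; rewrite ltnNge (ltnW lt).
rewrite E => /esym /prk_rho Ef; have := fi (f' u).
by rewrite Ef ins_fu => E'; move: m; rewrite -E' eqxx.
Qed.

(** If [u] did worse than [q], stability of [f'] would make [q] improved, and then [improved_head]
    puts the mate of [u] no higher than [q]. *)
Lemma head_best q : e u q -> q != u -> rho u < prk f q -> prk f' u <= rho q.
Proof.
move=> ed qu lt; rewrite leqNgt; apply/negP => lt2.
have := stable_block sf' ed; rewrite leqNgt lt2 /= => le.
have iq : improved q by rewrite /improved qu (leq_ltn_trans le lt).
have [/andP[m _] le2] := improved_head iq.
by move: lt2; rewrite prk_mate // ltnNge le2.
Qed.

Lemma chain_ge v : chain v -> rho u <= rho v.
Proof. by case/orP => [/eqP -> //|/worsened_head /ltnW]. Qed.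

(** Comparing [v] with the predecessor of [v'] and inducting shows that the chain is one sequence of
    increasing rank, in which [f (f' v)] comes directly after [v]. *)
Lemma chain_next v v' : chain v -> worsened v' -> rho v < rho v' ->
  [/\ f' v != v, improved (f' v), worsened (f (f' v)) & rho (f (f' v)) <= rho v'].
Proof.
have [n] := ubnP (rho v'); elim: n v v' => // n IH v v'; rewrite ltnS => vn cv wv lt.
have [c0 lt0] := chain_pred wv.
have [m0 i0 _] := worsened_mate wv.
have [m1 _ _] := improved_mate i0.
set v0 := f' (f v') in c0 lt0 m1 *.
have E0 : f' v0 = f v' by rewrite /v0 fi'.
case: (ltngtP (rho v) (rho v0)) => [l|l|/rho_inj ->].
- have w0 : worsened v0.
    case/orP: c0 => // /eqP E; move: l; rewrite E ltnNge chain_ge //.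
  have [|a b c d] := IH v v0 _ cv w0 l; first exact: leq_trans lt0 vn.
  by split=> //; apply: leq_trans d (ltnW lt0).
- have w : worsened v.
    case/orP: cv => // /eqP E; move: l; rewrite E ltnNge chain_ge //.
  have [|_ _ _] := IH v0 v _ c0 w l; first exact: leq_trans lt vn.
  by rewrite E0 fi leqNgt lt.
- by rewrite E0 fi; split=> //; rewrite -E0 -[X in _ != X]fi' E0 eq_sym.
Qed.

(** The partner ranks of an improved vertex before and after the insertion are those of consecutive
    chain vertices, or [M] at the end of the path. Hence the intervals that different improved
    vertices jump over are disjoint. *)
Lemma crossing_uniq y q1 q2 : improved q1 -> improved q2 ->
  prk f' q1 < y <= prk f q1 -> prk f' q2 < y <= prk f q2 -> q1 = q2.
Proof.
have aux q q' : improved q -> improved q' -> y <= prk f q -> prk f' q' < y ->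
    ~ rho (f' q) < rho (f' q').
  move=> i i' le lt lt2.
  have [m c E] := improved_mate i; have [m' c' E'] := improved_mate i'.
  have w : worsened (f' q').
    case/orP: c' => // /eqP Eu; move: lt2; rewrite Eu ltnNge chain_ge //.
  have [_ _ wn le2] := chain_next c w lt2.
  move: le2; rewrite fi' E' => le2.
  have mn : f q != q.
    have [+ _ _] := worsened_mate wn; rewrite fi' fi; by rewrite eq_sym.
  by move: (leq_ltn_trans le2 lt); rewrite -(prk_mate mn) ltnNge le.
move=> i1 i2 /andP[a1 b1] /andP[a2 b2].
have E : rho (f' q1) = rho (f' q2).
  by apply/eqP; rewrite eqn_leq; apply/andP; split; rewrite leqNgt; apply/negP; apply: aux.
by rewrite -[q1]fi' -[q2]fi'; congr f'; apply: rho_inj.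
Qed.

(** The left side is the rank of the improved vertex following [v] on the path, the right side that
    of the one preceding [v']: the ranks of improved vertices increase along the path as well. *)
Lemma chain_mono v v' : chain v -> worsened v' -> rho v < rho v' -> prk f' v <= prk f v'.
Proof.
have [n] := ubnP (rho v' - rho v); elim: n v => // n IH v; rewrite ltnS => vn cv wv lt.
have [m i w le] := chain_next cv wv lt.
have E : prk f' v = prk f (f (f' v)).
  by rewrite !prk_mate ?fi //; case: (worsened_mate w); rewrite fi.
move: le; rewrite leq_eqVlt => /orP[/eqP/rho_inj <-|lt2]; first by rewrite E.
rewrite E; apply: leq_trans (ltnW w) _; apply: IH => //; last by rewrite /chain w orbT.
apply: leq_trans vn; apply: ltn_sub2l => //.
have [_ l] := chain_pred w; by move: l; rewrite fi fi'.
Qed.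

End Insertion.
End Rank.
End Stable.

(** * The greedy process *)

Section Greedy.
Variables (V : finType) (e : rel V) (s : seq V).
Hypotheses (e_sym : symmetric e) (e_irr : irreflexive e).
Hypotheses (s_uniq : uniq s) (s_all : forall v, v \in s).

Definition greedy_step (M : {set {set V}}) (v : V) : {set {set V}} :=
  if v \in cover M then M else
  if ohead [seq u <- s | e v u && (u \notin cover M)] is Some u
  then ([set v; u] |: M) else M.

Let rho v := index v s.
Local Notation prk := (partner_rank rho (size s)).

(** Here [s1] is the processed prefix. Edges are tested for blocking only from their end of smaller
    rank once it is processed, because its fate is then settled. *)
Record greedy_inv (s1 : seq V) (M : {set {set V}}) (f : V -> V) : Prop := GreedyInv {
  ginv_inv : involutive f;
  ginv_edge : forall v, f v != v -> e v (f v);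
  ginv_cover : cover M = [set v | f v != v];
  ginv_card : #|[set v | f v != v]| = 2 * #|M|;
  ginv_active : forall v, v \notin s1 -> f v != v -> f v \in s1;
  ginv_block : forall v w, v \in s1 -> e v w -> rho v < rho w ->
    (prk f v <= rho w) || (prk f w <= rho v) }.

Lemma ohead_filter_min (a : pred V) u : ohead [seq x <- s | a x] = Some u ->
  a u /\ forall w, a w -> rho u <= rho w.
Proof.
rewrite /rho; elim: s => //= z t IH; case: ifP => [az [<-]|az /IH [au H]].
  by rewrite eqxx.
split=> // w aw; case: eqP => [E|_]; first by rewrite -E az in au.
by case: eqP => [E|_]; [rewrite -E az in aw | rewrite ltnS H].
Qed.

Lemma greedy_step_inv s1 v s2 M f : s = s1 ++ v :: s2 -> greedy_inv s1 M f ->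
  exists f', greedy_inv (rcons s1 v) (greedy_step M v) f'.
Proof.
move=> Es [fi fe fcov fcard fact fbl].
have vs1 : v \notin s1 by move: s_uniq; rewrite Es cat_uniq /= => /and3P[_ /norP[]].
have rv : rho v = size s1 by rewrite /rho Es index_cat (negbTE vs1) /= eqxx addn0.
have rlt z : z \in s1 -> rho z < rho v.
  by move=> zs; rewrite rv /rho Es index_cat zs index_mem.
have mem_act w : rho v < rho w -> f w != w -> prk f w <= rho v.
  move=> lt m; rewrite prk_mate //; apply/ltnW/rlt/fact => //.
  by apply: contraTN lt => /rlt; rewrite -leqNgt => /ltnW.
rewrite /greedy_step fcov inE.
case: ifPn => [m|/negPn/eqP fv].
  exists f; split=> //.
    by move=> z; rewrite mem_rcons inE negb_or => /andP[_ z1] mz; rewrite mem_rcons inE fact ?orbT.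
  move=> z w; rewrite mem_rcons inE => /predU1P[->|]; last exact: fbl.
  by move=> _ lt; rewrite prk_mate // (leq_trans _ (ltnW lt)) // ltnW // rlt // fact.
case E: ohead => [u|]; last first.
  exists f; split=> //.
    by move=> z; rewrite mem_rcons inE negb_or => /andP[_ z1] mz; rewrite mem_rcons inE fact ?orbT.
  move=> z w; rewrite mem_rcons inE => /predU1P[->|]; last exact: fbl.
  move=> ew lt; rewrite mem_act ?orbT //.
  apply: contraT => fw.
  have : w \in [seq u <- s | e v u && (u \notin [set v0 | f v0 != v0])].
    by rewrite mem_filter ew inE fw s_all.
  by case: seq.filter E.
have [/andP[euv +] umin] := ohead_filter_min E; rewrite inE => /negPn/eqP fu.
have uv : u != v by apply: contraTneq euv => ->; rewrite e_irr.
pose f' z := if z == v then u else if z == u then v else f z.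
have f'v : f' v = u by rewrite /f' eqxx.
have f'u : f' u = v by rewrite /f' (negbTE uv) eqxx.
have f'o z : z != v -> z != u -> f' z = f z by rewrite /f' => /negbTE -> /negbTE ->.
have fo z : z != v -> z != u -> f z != v /\ f z != u.
  move=> zv zu; split; [apply: contraNneq zv|apply: contraNneq zu] => Ez.
    by rewrite -(fi z) Ez fv.
  by rewrite -(fi z) Ez fu.
have f'm z : f z != z -> f' z = f z.
  by move=> m; apply: f'o; apply: contraNneq m => ->; rewrite ?fv ?fu.
(* A greedy step never worsens a partner, so an edge that does not block before the step does not
   block after it. *)
have f'le z : prk f' z <= prk f z.
  case: (eqVneq (f z) z) => [Ez|m].
    rewrite {2}/partner_rank Ez eqxx; apply: prk_le => y; rewrite /rho index_mem; exact: s_all.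
  by rewrite (@prk_eq _ _ _ f' f) ?f'm.
have covE : [set z | f' z != z] = [set v; u] :|: [set z | f z != z].
  apply/setP => z; rewrite !inE; case: (eqVneq z v) => [->|zv]; first by rewrite f'v uv.
  case: (eqVneq z u) => [->|zu]; first by rewrite f'u eq_sym uv.
  by rewrite f'o.
exists f'; split.
- move=> z; case: (eqVneq z v) => [->|zv]; first by rewrite f'v f'u.
  case: (eqVneq z u) => [->|zu]; first by rewrite f'u f'v.
  by have [a b] := fo z zv zu; rewrite (f'o z) // f'o.
- move=> z; case: (eqVneq z v) => [->|zv]; first by rewrite f'v.
  case: (eqVneq z u) => [->|zu]; first by rewrite f'u e_sym.
  by rewrite f'o //; apply: fe.
- by rewrite covE /cover bigcup_setU big_set1 -/(cover M) fcov.
- have nM : [set v; u] \notin M.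
    apply/negP => inM; have : v \in cover M by apply/bigcupP; exists [set v; u]; rewrite // !inE eqxx.
    by rewrite fcov inE fv eqxx.
  rewrite covE cardsU1 nM /= cardsU cards2 eq_sym uv.
  rewrite (_ : _ :&: _ = set0) ?cards0 ?fcard; last first.
    apply/setP => z; rewrite !inE; case: (eqVneq z v) => [->|_]; first by rewrite fv eqxx.
    by case: (eqVneq z u) => [->|_] //=; rewrite fu eqxx.
  by rewrite subn0 mulnDr muln1.
- move=> z; rewrite !mem_rcons !inE negb_or => /andP[zv z1].
  case: (eqVneq z u) => [->|zu]; first by rewrite f'u eqxx.
  by rewrite f'o // => m; rewrite fact ?orbT.
- move=> z w; rewrite mem_rcons inE => /predU1P[->|z1] ezw lt.
    case: (eqVneq (f w) w) => [fw|m]; last first.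
      by rewrite orbC (leq_trans (f'le w)) // mem_act.
    by rewrite prk_mate f'v // umin // ezw inE fw eqxx.
  have := fbl _ _ z1 ezw lt.
  by case/orP => le; rewrite (leq_trans (f'le _) le) ?orbT.
Qed.

Lemma greedy_stable : exists f, stable e rho (size s) f /\
  #|[set v | f v != v]| = 2 * #|foldl greedy_step set0 s|.
Proof.
have H n : n <= size s -> exists f, greedy_inv (take n s) (foldl greedy_step set0 (take n s)) f.
  elim: n => [_|n IH lt].
    exists id; rewrite take0 /=; split=> //.
    - by move=> v; rewrite eqxx.
    - by rewrite /cover big_set0; apply/setP => v; rewrite !inE eqxx.
    - by rewrite cards0; apply/eqP; rewrite cards_eq0; apply/eqP/setP => v; rewrite !inE eqxx.
    - by move=> v _; rewrite eqxx.
  have [f inv] := IH (ltnW lt).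
  case Ed: (drop n s) => [|v s2]; first by move: (congr1 size Ed); rewrite size_drop /= => /eqP; rewrite subn_eq0 leqNgt lt.
  have Es : s = take n s ++ v :: s2 by rewrite -Ed cat_take_drop.
  have -> : take n.+1 s = rcons (take n s) v.
    by rewrite (take_nth v) // -[n]addn0 -nth_drop Ed addn0.
  rewrite foldl_rcons; exact: greedy_step_inv Es inv.
have [f] := H _ (leqnn _); rewrite take_size => -[fi fe fcov fcard fact fbl].
exists f; split=> //; split=> // v w evw.
case: (ltngtP (rho v) (rho w)) => [lt|lt|E]; first exact: fbl.
  by rewrite orbC; apply: fbl => //; rewrite e_sym.
have Evw : v = w.
  by rewrite -(nth_index v (s_all v)) -/(rho v) E /rho nth_index.
by rewrite Evw e_irr in evw.
Qed.

End Greedy.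

(** * Composite ranks and the two ends of an edge *)

(** Stability depends on the ranks only through their order. *)
Lemma stable_transfer (V : finType) (e : rel V) (rho rho' : V -> nat) M M' f :
  (forall v, rho v < M) -> (forall v, rho' v < M') ->
  (forall a b, (rho a <= rho b) = (rho' a <= rho' b)) ->
  stable e rho M f -> stable e rho' M' f.
Proof.
move=> lt lt' E [fi fe fb]; split=> // v w evw.
have tr z y : partner_rank rho M f z <= rho y -> partner_rank rho' M' f z <= rho' y.
  rewrite /partner_rank; case: ifP => [_|_]; last by rewrite E.
  by rewrite leqNgt lt.
by case/orP: (fb _ _ evw) => /tr ->; rewrite ?orbT.
Qed.

Definition vcard (V : finType) : nat := #|V|.

Lemma enum_rank_lt (V : finType) (v : V) : enum_rank v < vcard V.
Proof. exact: ltn_ord. Qed.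

Section CompositeRank.
Variable V : finType.
Local Notation K := (vcard V).

(* Ties between equal ranks are broken by the enumeration of V. *)
Definition crank (r : V -> nat) (v : V) : nat := r v * K + enum_rank v.

Lemma crank_lt r t v : (crank r v < t * K) = (r v < t).
Proof.
have lt := enum_rank_lt v.
rewrite /crank -ltn_divLR ?divnMDl ?divn_small ?addn0 //; exact: leq_ltn_trans lt.
Qed.

Lemma crank_inj r : injective (crank r).
Proof.
move=> a b; rewrite /crank.
have la := enum_rank_lt a; have lb := enum_rank_lt b => E.
apply: enum_rank_inj; apply: val_inj; move: la lb E => /=.
set i := nat_of_ord _; set j := nat_of_ord _ => la lb E.
have := congr1 (modn^~ K) E; rewrite /= !modnMDl !modn_small //.
Qed.

Lemma crank_le r a b : (crank r a <= crank r b) =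
  ((r a < r b) || (r a == r b) && (enum_rank a <= enum_rank b)).
Proof.
rewrite /crank; have := enum_rank_lt a; have := enum_rank_lt b.
set i := nat_of_ord (enum_rank a); set j := nat_of_ord (enum_rank b) => lb la.
case: (ltngtP (r a) (r b)) => [l|l|->] /=; last by rewrite leq_add2l.
  have := leq_mul l (leqnn K); rewrite mulSn => H; apply/idP; lia.
have := leq_mul l (leqnn K); rewrite mulSn => H; apply/negbTE; rewrite -ltnNge; lia.
Qed.

Lemma stable_exists (e : rel V) r N : symmetric e -> irreflexive e ->
  (forall v, r v < N) -> exists f, stable e (crank r) (N * K) f.
Proof.
move=> es ei rN.
pose s := sort (fun a b => crank r a <= crank r b) (enum V).
have tot : total (fun a b => crank r a <= crank r b) by move=> a b; apply: leq_total.
have su : uniq s by rewrite sort_uniq enum_uniq.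
have sa v : v \in s by rewrite mem_sort mem_enum.
have [f [sf _]] := greedy_stable es ei su sa.
exists f; apply: stable_transfer sf => [v|v|a b]; first by rewrite index_mem.
  by rewrite crank_lt.
have tr : transitive (fun a b => crank r a <= crank r b) by move=> y x z; apply: leq_trans.
have srt : sorted (fun a b => crank r a <= crank r b) s by apply: sort_sorted.
have le x y : index x s <= index y s -> crank r x <= crank r y.
  exact: (sorted_leq_index tr (fun z => leqnn _) srt).
apply/idP/idP; first exact: le.
case: (leqP (index a s) (index b s)) => // lt l2.
have := le _ _ (ltnW lt) => l3.
have E : a = b by apply: (@crank_inj r); apply/eqP; rewrite eqn_leq l2 l3.
by move: lt; rewrite E ltnn.
Qed.

End CompositeRank.

(** * The ends of an edge, all outside ranks being fixed *)

Section LocalFacts.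
Variables (V : finType) (e : rel V) (N : nat).
Hypotheses (e_sym : symmetric e) (e_irr : irreflexive e).
Local Notation K := (vcard V).

Definition reset2 (r : V -> nat) u w x y : V -> nat :=
  fun v => if v == u then x else if v == w then y else r v.

(* [x < thr v m] says that [v], given rank [x], has composite rank below [m]. *)
Definition thr (v : V) (m : nat) := (m + (K.-1 - enum_rank v)) %/ K.

Lemma thrP (v : V) m x : (x < thr v m) = (x * K + enum_rank v < m).
Proof.
have lt := enum_rank_lt v; have K0 : 0 < K by apply: leq_ltn_trans lt.
rewrite /thr leq_divRL // mulSn; move: lt; set i := nat_of_ord (enum_rank v) => lt.
by apply/idP/idP => H; lia.
Qed.

Lemma thr_le (v w : V) m y : m <= y * K + enum_rank w -> thr v m <= y.+1.
Proof.
move=> le; have lt := enum_rank_lt w; have lt' := enum_rank_lt v.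
have K0 : 0 < K by apply: leq_ltn_trans lt.
rewrite -ltnS /thr ltn_divLR // !mulSn.
move: le lt lt'; set i := nat_of_ord (enum_rank w); set j := nat_of_ord _ => le lt lt'.
lia.
Qed.

Lemma thr_leN (v : V) m : m <= N * K -> thr v m <= N.
Proof.
move=> le; have lt := enum_rank_lt v.
have K0 : 0 < K by apply: leq_ltn_trans lt.
rewrite -ltnS /thr ltn_divLR // mulSn; lia.
Qed.

Variables (u w : V) (r : V -> nat) (fH : V -> V).
Hypotheses (uw : u != w) (euw : e u w) (rN : forall v, r v < N).
Hypothesis sH : stable (del u (del w e)) (crank r) (N * K) fH.
Let mH := partner_rank (crank r) (N * K) fH.

Definition low_nbr (t : nat) (v : V) : {set V} :=
  [set p | [&& e v p, p != u, p != w & r p < t]].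

Section Ranks.
Variables (x y : nat) (f : V -> V).
Hypotheses (xN : x < N) (yN : y < N).
Let r' := reset2 r u w x y.
Hypothesis sf : stable e (crank r') (N * K) f.
Local Notation prk := (partner_rank (crank r') (N * K)).

Let r'N v : r' v < N. Proof. by rewrite /r' /reset2; case: ifP => // _; case: ifP. Qed.
Let cN v : crank r' v < N * K. Proof. by rewrite crank_lt. Qed.
Let cu : crank r' u = x * K + enum_rank u. Proof. by rewrite /crank /r' /reset2 eqxx. Qed.
Let cw : crank r' w = y * K + enum_rank w.
Proof. by rewrite /crank /r' /reset2 eq_sym (negbTE uw) eqxx. Qed.
Let co v : v != u -> v != w -> crank r' v = crank r v.
Proof. by rewrite /crank /r' /reset2 => /negbTE -> /negbTE ->. Qed.

Let fHo v : fH v != v -> [/\ v != u, v != w, fH v != u & fH v != w].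
Proof. by move/(stable_edge sH) => /and3P[/and3P[_ a b] c d]. Qed.

Lemma mH_reset v : prk fH v = mH v.
Proof.
rewrite /mH /partner_rank; case: ifPn => // m.
by have [_ _ a b] := fHo m; rewrite co.
Qed.

Lemma sH_reset : stable (del u (del w e)) (crank r') (N * K) fH.
Proof.
case: sH => fi fe fb; split=> // a b ed; rewrite !mH_reset.
by have /and3P[/and3P[_ aw bw] au bu] := ed; rewrite !co //; apply: fb.
Qed.

(** Without [u], the vertex [w] must hold a partner ranked no higher than [u]; otherwise [w] would
    accept [u], and [head_best] would give [u] a partner of rank at most that of [w], below level
    [t]. That partner was improved by the insertion of [w], so it accepted [w]. *)
Lemma fail_level t : t * K <= prk f u -> y < t ->
  exists2 q, q \in low_nbr x.+1 w & y < thr w (mH q).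
Proof.
move=> ge yt.
have [f1 sf1] : exists f1, stable (del u e) (crank r') (N * K) f1.
  apply: stable_exists r'N; first exact: del_sym.
  by move=> v; rewrite /del e_irr.
have sH1 : stable (del w (del u e)) (crank r') (N * K) fH.
  by apply: stable_ext sH_reset; apply: del_comm.
have le : prk f1 w <= crank r' u.
  rewrite leqNgt; apply/negP => lt.
  have wu : w != u by rewrite eq_sym.
  have := head_best (@crank_inj _ _) cN sf1 sf euw wu lt.
  rewrite leqNgt => /negP; apply; apply: leq_trans ge; rewrite crank_lt.
  by rewrite /r' /reset2 eq_sym (negbTE uw) eqxx.
have m : f1 w != w by rewrite -(prk_matched cN) (leq_ltn_trans le).
have ip := head_improved (@crank_inj _ _) cN sH1 sf1 m.
have /and3P[ed _ pu] := stable_edge sf1 m.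
exists (f1 w); last first.
  case/andP: ip => _; rewrite mH_reset prk_mate ?(stable_inv sf1) 1?eq_sym //.
  by rewrite thrP -cw.
rewrite inE ed pu m /= ltnS.
move: le; rewrite prk_mate // crank_le /r' /reset2 eqxx (negbTE pu) (negbTE m).
by case/orP => [/ltnW//|/andP[/eqP -> _]].
Qed.

Hypothesis tri_free : forall q, e u q -> e q w -> False.

(** If [w] fails although [q] would have accepted it, the insertion of [u] must have moved the
    partner rank of [q] down across the rank of [w]. By [crossing_uniq] there is only one such [q],
    and the alternating path from [u] to it provides [p], the mate of [u]. *)
Lemma hurt_level t q : t * K <= prk f w -> q \in low_nbr t w -> y < thr w (mH q) ->
  (exists2 p, p \in low_nbr t u & x < thr u (mH p) <= y.+1) /\ (forall q', q' \in low_nbr t w -> y < thr w (mH q') -> q' = q).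
Proof.
move=> ge.
have [f1 sf1] : exists f1, stable (del w e) (crank r') (N * K) f1.
  apply: stable_exists r'N; first exact: del_sym.
  by move=> v; rewrite /del e_irr.
have key q1 : q1 \in low_nbr t w -> y < thr w (mH q1) ->
    improved (crank r') (N * K) u fH f1 q1 /\ prk f1 q1 < (crank r' w).+1 <= prk fH q1.
  rewrite inE thrP -cw mH_reset => /and4P[ed qu qw qt] lt; rewrite lt ltnS /improved qu /= andbT.
  have le : prk f1 q1 <= crank r' w.
    rewrite leqNgt; apply/negP => lt1.
    have := head_best (@crank_inj _ _) cN sf1 sf ed qw lt1.
    rewrite leqNgt => /negP; apply; apply: leq_trans ge.
    by rewrite crank_lt /r' /reset2 (negbTE qu) (negbTE qw).
  by rewrite mH_reset (leq_ltn_trans le lt).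
move=> qin qlt; have [iq cq] := key q qin qlt; split; last first.
  move=> q' q'in q'lt; have [iq' cq'] := key q' q'in q'lt.
  exact: (crossing_uniq (@crank_inj _ _) cN sH_reset sf1 iq' iq cq' cq).
have [m c E] := improved_mate (@crank_inj _ _) cN sH_reset sf1 iq.
move: qin; rewrite inE => /and4P[ed qu qw qt].
(* The one use of triangle-freeness: the path from [u] does not reach [q] in a single edge, so a
   worsened vertex precedes [q]. *)
have v_neq : f1 q != u.
  apply/negP => /eqP E1; have /and3P[e1 _ _] := stable_edge sf1 m.
  by apply: (tri_free (q := q)); [rewrite e_sym -E1 | rewrite e_sym].
have wv : worsened (crank r') (N * K) fH f1 (f1 q).
  by move: c; rewrite /chain (negbTE v_neq).
have lt := worsened_head (@crank_inj _ _) cN sH_reset sf1 wv.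
have cu0 : chain (crank r') (N * K) u fH f1 u by rewrite /chain eqxx.
(* The former mate of [f1 u] is the first worsened vertex, hence ranked no higher than [f1 q] and so
   no higher than [w]; this bounds the threshold of [p]. *)
have [m1 i1 w1 le1] := chain_next (@crank_inj _ _) cN sH_reset sf1 cu0 wv lt.
have [_ le2] := improved_head (@crank_inj _ _) cN sH_reset sf1 iq.
have /and3P[eup _ pw] := stable_edge sf1 m1.
exists (f1 u).
  rewrite inE eup m1 pw /=.
  have : crank r' (f1 u) < t * K.
    by apply: leq_ltn_trans le2 _; rewrite co // crank_lt.
  by rewrite co // crank_lt.
have mp : fH (f1 u) != f1 u.
  have [+ _ _] := worsened_mate (@crank_inj _ _) cN sH_reset sf1 w1.
  by rewrite (stable_inv sH) eq_sym.
apply/andP; split.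
  rewrite thrP -cu -mH_reset; case/andP: i1 => _.
  by rewrite prk_mate ?(stable_inv sf1) // eq_sym.
apply: (@thr_le _ w); rewrite -cw -mH_reset prk_mate //.
by apply: leq_trans le1 _; rewrite E; case/andP: cq; rewrite ltnS.
Qed.

End Ranks.
End LocalFacts.

(** * Counting failures *)

(** Without the two conditions the sum could be twice as large. For [a <= b] only one summand is
    active between [a] and [b], and beyond [b] the two add up to at most [a + b]. *)
Lemma hurt_sum (a b m : nat) :
  2 * (\sum_(k < m) ((a <= k) * minn b k.+1 + (b <= k) * minn a k.+1)) <= m * m.+1.
Proof.
wlog ab : a b / a <= b => [H|].
  case: (leqP a b) => [|/ltnW] /H // {}H; apply: leq_trans H.
  by rewrite leq_mul2l; apply/orP; right; apply: leq_sum => k _; rewrite addnC.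
(* The closed form of the doubled sum when [a <= b]. *)
pose F m := if m <= a then 0 else if m <= b then m * m.+1 - a * a.+1
            else b * b.+1 - a * a.+1 + 2 * ((m - b) * (a + b)).
have -> : 2 * (\sum_(k < m) ((a <= k) * minn b k.+1 + (b <= k) * minn a k.+1)) = F m.
  elim: m => [|m IH]; first by rewrite big_ord0 /F.
  rewrite big_ord_recr /= mulnDr {}IH /F.
  case: (ltnP m a) => am.
    have -> : (b <= m) = false by lia.
    by rewrite (ltnW am) !mul0n.
  case: (ltnP m b) => bm.
    have -> : minn b m.+1 = m.+1 by lia.
    rewrite !mul1n !mul0n addn0; have -> : m <= b by lia.
    case: ifP => h; last by nia.
    have -> : m = a by lia.
    nia.
  have -> : minn b m.+1 = b by lia.
  have -> : minn a m.+1 = a by lia.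
  rewrite !mul1n (subSn bm) mulSn.
  case: ifP => h; first by (have -> : b = m by lia); (have -> : m = a by lia); rewrite subnn; lia.
  case: ifP => h2; last by lia.
  have -> : m = b by lia.
  rewrite subnn; lia.
rewrite /F; case: ifP => // /negbT; rewrite -ltnNge => am.
case: ifP => [bm|/negbT]; first by lia.
rewrite -ltnNge => bm.
have [d ->] : exists d, m = b + d by exists (m - b); lia.
have [c ->] : exists c, b = a + c by exists (b - a); lia.
rewrite addKn; case: (leqP d a) => da.
  have [k ->] : exists k, a = d + k by exists (a - d); lia.
  rewrite !(mulnDl, mulnDr, mulnS, mulSn); nia.
have [k ->] : exists k, d = a + k by exists (d - a); lia.
rewrite !(mulnDl, mulnDr, mulnS, mulSn); nia.
Qed.

Lemma sum_bool_le (F : pred nat) N m :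
  (forall x, x < N -> F x -> x < m) -> \sum_(x < N) F x <= m.
Proof.
move=> H; apply: (@leq_trans (\sum_(x < N) (x < m))).
  by apply: leq_sum => x _; case: (boolP (F x)) => // /H ->.
elim: N {H} => [|n IH]; first by rewrite big_ord0.
rewrite big_ord_recr /=; case: (ltnP n m) => nm; last by rewrite addn0.
rewrite addn1; apply: leq_ltn_trans nm.
apply: (@leq_trans (\sum_(x < n) 1)); last by rewrite sum_nat_const card_ord muln1.
by apply: leq_sum => x _; case: (_ < _).
Qed.

Lemma sum_bool_compl (F : pred nat) N lo hi :
  hi <= N -> (forall x, x < N -> F x -> ~~ (lo <= x < hi)) -> \sum_(x < N) F x + (hi - lo) <= N.
Proof.
move=> hN H.
have -> : hi - lo = \sum_(x < N) (lo <= x < hi).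
  elim: N hi hN {H} => [|n IH] hi; first by rewrite big_ord0; lia.
  rewrite leq_eqVlt ltnS => /orP[/eqP ->|h]; last by rewrite big_ord_recr /= -IH //; lia.
  rewrite big_ord_recr /= ltnSn andbT.
  rewrite (eq_bigr (fun x : 'I_n => nat_of_bool (lo <= x < n))); last first.
    by move=> x _; rewrite ltn_ord (ltn_trans (ltn_ord x)).
  by rewrite -IH //; lia.
rewrite -big_split /= -[X in _ <= X](card_ord N) -sum1_card.
apply: leq_sum => x _; case: (boolP (F x)) => [Fx|_]; last by case: (_ && _).
by rewrite (negbTE (H _ (ltn_ord x) Fx)).
Qed.

Section SecondMax.
Variables (V : finType) (I : {set V}) (s : V -> nat).

Lemma ltn_bigmaxP x : reflect (exists2 p, p \in I & x < s p) (x < \max_(p in I) s p).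
Proof.
apply: (iffP idP) => [|[p pI]]; last by move/leq_trans; apply; apply: leq_bigmax_cond.
move=> lt; apply/exists_inP; rewrite -[X in is_true X]negbK; apply/negP.
rewrite negb_exists_in => /forall_inP H.
by move: lt; rewrite ltnNge => /negP; apply; apply/bigmax_leqP => p /H; rewrite -leqNgt.
Qed.

(** The witness is the second largest value counted with multiplicity, or 0 if there is at most one
    element. *)
Lemma second_max : exists b,
  (forall x, x < b -> exists p1 p2, [/\ p1 \in I, p2 \in I, p1 != p2, x < s p1 & x < s p2]) /\
  (forall p, p \in I -> s p < \max_(q in I) s q -> s p <= b).
Proof.
case: (set_0Vmem I) => [->|[i iI]].
  by exists 0; split=> // p; rewrite inE.
have [i0 i0I E] := eq_bigmax_cond s (A := [pred q in I]) (ltac:(by apply/card_gt0P; exists i)).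
have E' : \max_(q in I) s q = s i0 by [].
exists (\max_(q in I :\ i0) s q); split.
  move=> x lt.
  have [p] : exists2 p, p \in I :\ i0 & x < s p.
    apply/exists_inP; rewrite -[X in is_true X]negbK; apply/negP.
    rewrite negb_exists_in => /forall_inP H.
    by move: lt; rewrite ltnNge => /negP; apply; apply/bigmax_leqP => p /H; rewrite -leqNgt.
  rewrite !inE => /andP[pi pI] lp; exists p, i0; split=> //.
  by rewrite -E'; apply/ltn_bigmaxP; exists p.
move=> p pI; rewrite E' => lt; apply: (leq_bigmax_cond (F := s)).
by rewrite !inE pI andbT; apply: contraTneq lt => ->; rewrite ltnn.
Qed.
End SecondMax.

Section Level.
Variables (V : finType) (N : nat) (IP IQ : {set V}) (sP sQ : V -> nat) (FA FB : nat -> nat -> bool).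
Local Notation P := (\max_(p in IP) sP p).
Local Notation Q := (\max_(q in IQ) sQ q).
Hypothesis HA : forall x y, x < N -> y < N -> FA x y -> forall p, p \in IP -> x < sP p ->
  (exists2 q, q \in IQ & y < sQ q <= x.+1) /\ (forall p', p' \in IP -> x < sP p' -> p' = p).
Hypothesis HB : forall x y, x < N -> y < N -> FB x y -> forall q, q \in IQ -> y < sQ q ->
  (exists2 p, p \in IP & x < sP p <= y.+1) /\ (forall q', q' \in IQ -> y < sQ q' -> q' = q).
Hypotheses (PQ : P <= Q) (QN : Q <= N).

Let PN : P <= N. Proof. exact: leq_trans QN. Qed.

(** Here [a] and [b] are the second largest thresholds of [sQ] and [sP]. A failure at [y < a] would
    have two acceptors, against uniqueness; and when [y.+1 < P] the witness [p] is not of largest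
    threshold, so its threshold is at most [b]. *)
Lemma hurt_slices : exists a b,
  (forall y, y < Q -> \sum_(x < N) FB x y <=
     if P <= y.+1 then P else (a <= y) * minn b y.+1) /\
  (forall x, x < P -> \sum_(y < N) FA x y <=
     if P <= x.+1 then P else (b <= x) * minn a x.+1).
Proof.
have [b [b1 b2]] := second_max IP sP; have [a [a1 a2]] := second_max IQ sQ.
exists a, b; split=> [y yQ|x xP].
  have yN := leq_trans yQ QN; have [q qI ltq] := ltn_bigmaxP IQ sQ y yQ.
  case: ifP => Py.
    apply: (@sum_bool_le (FB^~ y)) => x xN h.
    have [[p pI /andP[ltp _]] _] := HB xN yN h qI ltq.
    by apply/ltn_bigmaxP; exists p.
  case: (leqP a y) => ay; last first.
    rewrite mul0n leqn0; apply/eqP; apply: big1 => x _.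
    case: (boolP (FB x y)) => // h.
    have [p1 [p2 [i1 i2 ne l1 l2]]] := a1 y ay.
    have [_ un] := HB (ltn_ord x) yN h i1 l1.
    by move: ne; rewrite (un p2) ?eqxx.
  rewrite mul1n; apply: (@sum_bool_le (FB^~ y)) => x xN h.
  have [[p pI /andP[ltp lep]] _] := HB xN yN h qI ltq.
  have := b2 p pI; move: Py => /negbT; rewrite -ltnNge => Py.
  rewrite (leq_ltn_trans lep Py) => /(_ isT) lb.
  by rewrite leq_min (leq_trans ltp lep) (leq_trans ltp lb).
have xN := leq_trans xP PN; have [p pI ltp] := ltn_bigmaxP IP sP x xP.
case: ifP => Px.
  apply: (@sum_bool_le (FA x)) => y yN h.
  have [[q qI /andP[ltq leq_]] _] := HA xN yN h pI ltp.
  by apply: leq_trans ltq _; apply: leq_trans leq_ _.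
case: (leqP b x) => bx; last first.
  rewrite mul0n leqn0; apply/eqP; apply: big1 => y _.
  case: (boolP (FA x y)) => // h.
  have [p1 [p2 [i1 i2 ne l1 l2]]] := b1 x bx.
  have [_ un] := HA xN (ltn_ord y) h i1 l1.
  by move: ne; rewrite (un p2) ?eqxx.
rewrite mul1n; apply: (@sum_bool_le (FA x)) => y yN h.
have [[q qI /andP[ltq leq_]] _] := HA xN yN h pI ltp.
have := a2 q qI; move: Px => /negbT; rewrite -ltnNge => Px.
rewrite (leq_ltn_trans leq_ (leq_trans Px PQ)) => /(_ isT) la.
by rewrite leq_min (leq_trans ltq leq_) (leq_trans ltq la).
Qed.

(** This is [hurt_sum], except that the weaker bound [P] of [hurt_slices] intervenes for the single
    index [P.-1], at a cost of at most [2 * P] before doubling. *)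
Lemma hurt_square m : m <= P ->
  2 * (\sum_(k < m) (\sum_(x < N) FB x k + \sum_(y < N) FA k y)) <= m * m.+1 + 4 * P.
Proof.
move=> mP; have [a [b [H1 H2]]] := hurt_slices.
apply: (@leq_trans (2 * \sum_(k < m) (((a <= k) * minn b k.+1 + (b <= k) * minn a k.+1)
   + (P.-1 == k) * (2 * P)))).
  rewrite leq_mul2l; apply: leq_sum => k _.
  have kP := leq_trans (ltn_ord k) mP.
  have := H1 _ (leq_trans kP PQ); have := H2 _ kP.
  case: ifP => h; last by move=> h1 h2; rewrite addnC (leq_trans (leq_add h1 h2)) // addnC leq_addr.
  have -> : (P.-1 == k) = true by move: h kP; set p := bigop _ _ _; lia.
  by move=> h1 h2; rewrite (leq_trans (leq_add h2 h1)) // mul1n mul2n -addnn leq_addl.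
rewrite big_split /= mulnDr; apply: leq_add; first exact: hurt_sum.
rewrite (_ : 4 * P = 2 * (2 * P)); last lia.
rewrite leq_mul2l /=.
have : \sum_(i < m) (P.-1 == i) <= 1.
  elim: m {mP} => [|m IH]; first by rewrite big_ord0.
  rewrite big_ord_recr /=; case: eqP => [E|_]; last by rewrite addn0.
  rewrite big1 // => i _; rewrite E; case: eqP => // E2; have := ltn_ord i; lia.
rewrite -big_distrl /= => h; nia.
Qed.

(** The square of side [P] contributes about half its area, the strip from [P] to [Q] at most its
    full area; together [P * Q - P * P / 2] up to a term linear in [N]. *)
Lemma hurt_level_sum :
  2 * (\sum_(y < Q) \sum_(x < N) FB x y + \sum_(x < P) \sum_(y < N) FA x y) + P * P <=
  2 * (P * Q) + 5 * N.
Proof.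
have H := hurt_square (leqnn P); have [a [b [H1 _]]] := hurt_slices.
have -> : \sum_(y < Q) \sum_(x < N) FB x y =
  \sum_(y < P) \sum_(x < N) FB x y + \sum_(P <= y < Q) \sum_(x < N) FB x y.
  by rewrite -!(big_mkord xpredT (fun y => \sum_(x < N) FB x y)) -big_cat_nat.
have : \sum_(P <= y < Q) \sum_(x < N) FB x y <= (Q - P) * P.
  rewrite -sum_nat_const_nat big_nat_cond [X in _ <= X]big_nat_cond.
  apply: leq_sum => y /andP[/andP[h1 h2] _]; apply: leq_trans (H1 _ h2) _.
  by rewrite (leq_trans h1).
move: H; rewrite big_split /=; nia.
Qed.
End Level.

(** * Acceptance profiles *)

Lemma split_sum (F : nat -> nat) p m N c b : p <= N -> m <= N ->
  (forall x, p <= x < N -> F x + (x < m) * c <= b) ->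
  \sum_(x < N) F x + (m - p) * c <= \sum_(x < p) F x + (N - p) * b.
Proof.
move=> pN mN H.
have -> : \sum_(x < N) F x = \sum_(x < p) F x + \sum_(p <= x < N) F x.
  by rewrite -!(big_mkord xpredT F) -big_cat_nat.
rewrite -addnA leq_add2l.
have -> : (m - p) * c = \sum_(p <= x < N) (x < m) * c.
  rewrite -big_distrl /=; congr (_ * _).
  case: (leqP p m) => pm; last first.
    rewrite big_nat_cond big1 => [|x /andP[/andP[h _] _]]; last by rewrite ltnNge (leq_trans (ltnW pm) h).
    by apply/eqP; rewrite subn_eq0 ltnW.
  rewrite (big_cat_nat (n := m)) //= [X in _ + X]big_nat_cond [X in _ + X]big1 => [|x /andP[/andP[h _] _]]; last by rewrite ltnNge h.
  rewrite addn0 big_nat_cond (eq_bigr (fun=> 1)) => [|x /andP[/andP[_ ->]]//].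
  by rewrite -big_nat_cond sum_nat_const_nat muln1.
rewrite -big_split /= -sum_nat_const_nat big_nat_cond [X in _ <= X]big_nat_cond.
by apply: leq_sum => x /andP[h _]; apply: H.
Qed.

Section Profile.
Variables (V : finType) (N : nat) (IP IQ : nat -> {set V}) (sP sQ : V -> nat).
Variables (A B : nat -> nat -> nat -> bool).
Hypotheses (IP_mono : forall t t', t <= t' -> IP t \subset IP t').
Hypotheses (IQ_mono : forall t t', t <= t' -> IQ t \subset IQ t').
Hypotheses (sP_le : forall p, sP p <= N) (sQ_le : forall q, sQ q <= N).
Hypothesis HA1 : forall x y t, x < N -> y < N -> t <= N -> ~~ A x y t ->
  forall p, p \in IP t -> x < sP p ->
  (exists2 q, q \in IQ t & y < sQ q <= x.+1) /\ (forall p', p' \in IP t -> x < sP p' -> p' = p).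
Hypothesis HB1 : forall x y t, x < N -> y < N -> t <= N -> ~~ B x y t ->
  forall q, q \in IQ t -> y < sQ q ->
  (exists2 p, p \in IP t & x < sP p <= y.+1) /\ (forall q', q' \in IQ t -> y < sQ q' -> q' = q).
Hypothesis HA2 : forall x y t, x < N -> y < N -> t <= N -> ~~ A x y t -> y < t ->
  exists2 q, q \in IQ x.+1 & y < sQ q.
Hypothesis HB2 : forall x y t, x < N -> y < N -> t <= N -> ~~ B x y t -> x < t ->
  exists2 p, p \in IP y.+1 & x < sP p.

(** The ranks at which [u] has an acceptor below level [t] form an initial segment, whose length is
    [capP t]; [capQ t] is the same for [w]. The relations [A] and [B] say that [u], respectively
    [w], gets a partner below level [t]. *)
Definition capP t := \max_(p in IP t) sP p.
Definition capQ t := \max_(q in IQ t) sQ q.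
Definition rowA x t := \sum_(y < N) ~~ A x y t.
Definition colB y t := \sum_(x < N) ~~ B x y t.
Definition failA t := \sum_(x < N) rowA x t.
Definition failB t := \sum_(y < N) colB y t.

Lemma capP_mono t t' : t <= t' -> capP t <= capP t'.
Proof.
move=> /IP_mono /subsetP s; apply/bigmax_leqP => p /s; exact: (leq_bigmax_cond (F := sP)).
Qed.
Lemma capQ_mono t t' : t <= t' -> capQ t <= capQ t'.
Proof.
move=> /IQ_mono /subsetP s; apply/bigmax_leqP => p /s; exact: (leq_bigmax_cond (F := sQ)).
Qed.
Lemma capP_le t : capP t <= N. Proof. by apply/bigmax_leqP. Qed.
Lemma capQ_le t : capQ t <= N. Proof. by apply/bigmax_leqP. Qed.

Lemma fail_capQ x y t : x < N -> y < N -> t <= N -> ~~ A x y t -> y < t -> y < capQ x.+1.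
Proof. by move=> a b c d /(HA2 a b c d) H; apply/ltn_bigmaxP. Qed.
Lemma fail_capP x y t : x < N -> y < N -> t <= N -> ~~ B x y t -> x < t -> x < capP y.+1.
Proof. by move=> a b c d /(HB2 a b c d) H; apply/ltn_bigmaxP. Qed.

Lemma rowA_cap k : k < N -> rowA k N <= capQ k.+1.
Proof. by move=> kN; apply: (@sum_bool_le (fun y => ~~ A k y N)) => y yN h; apply: (fail_capQ kN yN (leqnn N) h). Qed.
Lemma colB_cap k : k < N -> colB k N <= capP k.+1.
Proof. by move=> kN; apply: (@sum_bool_le (fun x => ~~ B x k N)) => x xN h; apply: (fail_capP xN kN (leqnn N) h). Qed.

Lemma rowA_diag k : k < capP N -> rowA k N <= k.+1.
Proof.
move=> kP; have kN := leq_trans kP (capP_le N); have [p pI lt] := ltn_bigmaxP _ _ _ kP.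
apply: (@sum_bool_le (fun y => ~~ A k y N)) => y yN h.
by have [[q _ /andP[l1 l2]] _] := HA1 kN yN (leqnn N) h pI lt; apply: leq_trans l2.
Qed.
Lemma colB_diag k : k < capQ N -> colB k N <= k.+1.
Proof.
move=> kP; have kN := leq_trans kP (capQ_le N); have [p pI lt] := ltn_bigmaxP _ _ _ kP.
apply: (@sum_bool_le (fun x => ~~ B x k N)) => x xN h.
by have [[q _ /andP[l1 l2]] _] := HB1 xN kN (leqnn N) h pI lt; apply: leq_trans l2.
Qed.

Lemma square_sum m : capP N <= capQ N -> m <= capP N ->
  2 * (\sum_(k < m) (colB k N + rowA k N)) <= m * m.+1 + 4 * N.
Proof.
move=> PQ mP.
have := @hurt_square V N (IP N) (IQ N) sP sQ (fun x y => ~~ A x y N) (fun x y => ~~ B x y N)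
  (fun x y a b => HA1 a b (leqnn N)) (fun x y a b => HB1 a b (leqnn N)) PQ (capQ_le N) m mP.
move=> H; apply: leq_trans H _; rewrite leq_add2l leq_mul2l; exact: capP_le.
Qed.

Lemma hurt_total t : t <= N ->
  2 * (\sum_(y < capQ t) colB y t + \sum_(x < capP t) rowA x t) + minn (capP t) (capQ t) ^ 2
  <= 2 * (capP t * capQ t) + 5 * N.
Proof.
move=> tN; case: (leqP (capP t) (capQ t)) => PQ.
  rewrite expnS expn1.
  exact: (@hurt_level_sum V N (IP t) (IQ t) sP sQ (fun x y => ~~ A x y t) (fun x y => ~~ B x y t)
  (fun x y a b => HA1 a b tN) (fun x y a b => HB1 a b tN) PQ (capQ_le t)).
rewrite expnS expn1 addnC [capP t * _]mulnC addnC [X in 2 * X]addnC.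
exact: (@hurt_level_sum V N (IQ t) (IP t) sQ sP (fun y x => ~~ B x y t) (fun y x => ~~ A x y t)
  (fun y x a b => HB1 b a tN) (fun y x a b => HA1 b a tN) (ltnW PQ) (capP_le t)).
Qed.

(** Even where [u] has no acceptor, it succeeds when both ranks are below [t] and [y] is at least
    [capQ t], since a failure needs [y < capQ x.+1]. The product on the left is the area of this
    rectangle of successes. *)
Lemma failA_out t : t <= N ->
  failA t + (t - capP t) * (t - capQ t) <= \sum_(x < capP t) rowA x t + (N - capP t) * N.
Proof.
move=> tN; apply: (split_sum (F := rowA^~ t)) => //; first exact: capP_le.
move=> x /andP[_ xN]; case: (ltnP x t) => xt; rewrite ?mul1n ?mul0n ?addn0.
  apply: (@sum_bool_compl (fun y => ~~ A x y t)) => // y yN h.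
  apply/negP => /andP[h1 h2]; have := fail_capQ xN yN tN h h2.
  by rewrite ltnNge (leq_trans _ h1) // capQ_mono.
by apply: (@sum_bool_le (fun y => ~~ A x y t)).
Qed.

Lemma failB_out t : t <= N ->
  failB t + (t - capQ t) * (t - capP t) <= \sum_(y < capQ t) colB y t + (N - capQ t) * N.
Proof.
move=> tN; apply: (split_sum (F := colB^~ t)) => //; first exact: capQ_le.
move=> y /andP[_ yN]; case: (ltnP y t) => yt; rewrite ?mul1n ?mul0n ?addn0.
  apply: (@sum_bool_compl (fun x => ~~ B x y t)) => // x xN h.
  apply/negP => /andP[h1 h2]; have := fail_capP xN yN tN h h2.
  by rewrite ltnNge (leq_trans _ h1) // capP_mono.
by apply: (@sum_bool_le (fun x => ~~ B x y t)).
Qed.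

(** Once [t] exceeds every acceptance rank of [u], the values of [x] from [capP N] to [t] are
    successes of [w] for all [y], even those above [t]; for [y < t] the range starts already at
    [capP t]. *)
Lemma failB_outT t : t <= N -> capP N <= t ->
  failB t + (t - capQ t) * (capP N - capP t)
  <= \sum_(y < capQ t) colB y t + (N - capQ t) * (N - (t - capP N)).
Proof.
move=> tN Tt; apply: (split_sum (F := colB^~ t)) => //; first exact: capQ_le.
have Pt := capP_mono tN.
move=> y /andP[_ yN]; case: (ltnP y t) => yt; rewrite ?mul1n ?mul0n ?addn0.
  have : colB y t + (t - capP t) <= N.
    apply: (@sum_bool_compl (fun x => ~~ B x y t)) => // x xN h.
    apply/negP => /andP[h1 h2]; have := fail_capP xN yN tN h h2.
    by rewrite ltnNge (leq_trans _ h1) // capP_mono.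
  lia.
have : colB y t + (t - capP N) <= N.
  apply: (@sum_bool_compl (fun x => ~~ B x y t)) => // x xN h.
  apply/negP => /andP[h1 h2]; have := fail_capP xN yN tN h h2.
  by rewrite ltnNge (leq_trans _ h1) // capP_mono.
lia.
Qed.

Lemma level_sym t : t <= N ->
  2 * (failA t + failB t) + 4 * ((t - capP t) * (t - capQ t)) + minn (capP t) (capQ t) ^ 2
  <= 2 * (capP t * capQ t) + 2 * ((N - capP t) * N) + 2 * ((N - capQ t) * N) + 5 * N.
Proof.
move=> tN; have := hurt_total tN; have := failA_out tN; have := failB_out tN.
rewrite [(t - capQ t) * _]mulnC; set a := (t - _) * _; set m := minn _ _ ^ 2.
set c := capP t * _; set d1 := _ * N; set d2 := _ * N; lia.
Qed.

Lemma level_T t : t <= N -> capP N <= t ->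
  2 * (failA t + failB t) + 2 * ((t - capP t) * (t - capQ t))
   + 2 * ((t - capQ t) * (capP N - capP t)) + minn (capP t) (capQ t) ^ 2
  <= 2 * (capP t * capQ t) + 2 * ((N - capP t) * N)
     + 2 * ((N - capQ t) * (N - (t - capP N))) + 5 * N.
Proof.
move=> tN Tt; have := hurt_total tN; have := failA_out tN; have := failB_outT tN Tt.
set a := (t - _) * _; set m := minn _ _ ^ 2; set a2 := (t - capP t) * _.
set c := capP t * _; set d1 := _ * N; set d2 := (N - capQ t) * _; lia.
Qed.

End Profile.

(** * Own-hurt vertices *)

Section OwnHurt.
Variables (V : finType) (e : rel V) (rho : V -> nat) (M : nat) (f : V -> V).
Hypotheses (e_sym : symmetric e) (e_irr : irreflexive e).
Hypotheses (rho_inj : injective rho) (rho_lt : forall v, rho v < M).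
Hypothesis sf : stable e rho M f.
Hypothesis girth : forall c : seq V, 2 < size c -> ucycle e c -> odd (size c) -> 129 <= size c.
Local Notation prk := (partner_rank rho M).

(* If [v] lies on the alternating path of an insertion, the next vertex of the
   path is the former mate of [f v]; here it is described by [f] alone. *)
Definition best_reply v z := [/\ e (f v) z, rho (f v) < prk f z &
  forall z', e (f v) z' -> rho (f v) < prk f z' -> rho z <= rho z'].

Lemma best_reply_uniq v z z' : best_reply v z -> best_reply v z' -> z = z'.
Proof.
by move=> [a b c] [a' b' c']; apply: rho_inj; apply/eqP; rewrite eqn_leq c // c'.
Qed.

Section OneVertex.
Variables (u : V) (fu : V -> V).
Hypothesis sfu : stable (del u e) rho M fu.
Local Notation worse := (worsened rho M fu f).
Local Notation ch := (chain rho M u fu f).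

(** A reply [z'] ranked lower than the next chain vertex could not block [fu], so it would itself be
    worsened; [chain_mono] from [z'] to the next vertex then contradicts that [z'] prefers [f v] to
    its mate in [f]. *)
Lemma chain_step v z : ch v -> worse z -> rho v < rho z ->
  [/\ worse (fu (f v)), rho v < rho (fu (f v)), rho (fu (f v)) <= rho z & best_reply v (fu (f v))].
Proof.
move=> cv wz lt.
have [m im wn le] := chain_next rho_inj rho_lt sfu sf cv wz lt.
have [m1 _ E1] := worsened_mate rho_inj rho_lt sfu sf wn.
rewrite (stable_inv sfu) in m1 E1.
have m2 : fu (f v) != f v by rewrite eq_sym.
have qu : f v != u by case/andP: im.
have /and3P[ed _ _] := stable_edge sfu m2.
have E2 : prk fu (f v) = rho (fu (f v)) by rewrite prk_mate.
have E3 : prk f (f v) = rho v by rewrite prk_mate ?(stable_inv sf) // eq_sym.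
split=> //; first by move: im; rewrite /improved E2 E3 => /andP[].
split=> //; first by rewrite E1.
move=> z' ez' lt'.
have zu : z' != u.
  apply/eqP => E; have [/andP[mu _] le2] := improved_head rho_inj rho_lt sfu sf im.
  by move: lt'; rewrite E prk_mate // ltnNge le2.
have d : del u e (f v) z' by rewrite /del ez' qu zu.
case/orP: (stable_block sfu d) => [|le3]; first by rewrite E2.
rewrite leqNgt; apply/negP => lt3.
have wz' : worse z' by apply: leq_ltn_trans le3 lt'.
have cz' : ch z' by rewrite /chain; apply/orP; right.
have := chain_mono rho_inj rho_lt sfu sf cz' wn lt3.
by rewrite -E1 leqNgt lt'.
Qed.

Definition below z := [set v | ch v && (rho v < rho z)].

Lemma alternating_path z : ch z -> exists p i,
  [/\ path e z p, last z p = u, uniq (z :: p), size p = 2 * i & i <= #|below z|] /\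
  (forall w, w \in z :: p -> (ch w && (rho w <= rho z)) ||
     [&& improved rho M u fu f w, ch (fu w) & rho (fu w) <= rho z]).
Proof.
have [n] := ubnP (rho z); elim: n z => // n IH z; rewrite ltnS => zn cz.
have [zu|zu] := eqVneq z u.
  exists [::], 0; split; first by split.
  by move=> w; rewrite inE => /eqP ->; rewrite cz leqnn.
have wz : worse z by move: cz; rewrite /chain (negbTE zu).
have [cy lt] := chain_pred rho_inj rho_lt sfu sf wz.
set y := f (fu z) in cy lt.
have [m iq _] := worsened_mate rho_inj rho_lt sfu sf wz.
have [m' _ _] := improved_mate rho_inj rho_lt sfu sf iq.
have [p [i [[pp lp up sp ip] mem]]] := IH y (leq_trans lt zn) cy.
exists [:: fu z, y & p], i.+1.
have /and3P[e1 _ _] := stable_edge sfu m.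
have e2 := stable_edge sf m'.
have zq : z \notin y :: p.
  apply/negP => /mem /orP[/andP[_]|/and3P[]]; first by rewrite leqNgt lt.
  by case/andP => _; rewrite ltnNge (ltnW wz).
have qq : fu z \notin y :: p.
  apply/negP => /mem /orP[/andP[c _]|/and3P[_ _]].
    case/andP: iq => qu lt1; move: c.
    by rewrite /chain (negbTE qu) /= /worsened ltnNge (ltnW lt1).
  by rewrite (stable_inv sfu) leqNgt lt.
split.
  split=> //.
  - by rewrite /= e1 e2.
  - by rewrite cons_uniq in_cons negb_or [z == _]eq_sym m zq cons_uniq qq up.
  - by rewrite /= sp mulnS.
  - apply: leq_ltn_trans ip _; apply: proper_card; apply/properP; split.
      by apply/subsetP => v; rewrite !inE => /andP[-> h] /=; apply: ltn_trans h lt.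
    by exists y; rewrite !inE ?cy ?lt ?ltnn ?andbF.
move=> w; rewrite in_cons => /orP[/eqP ->|]; first by rewrite cz leqnn.
rewrite in_cons => /orP[/eqP ->|/mem].
  by rewrite iq (stable_inv sfu) cz leqnn /= orbT.
by case/orP => [/andP[-> h]|/and3P[-> -> h]]; rewrite (leq_trans h (ltnW lt)) ?orbT.
Qed.

(* The alternating path from [u] to [z] closes up with the edge [z u] to an odd cycle. *)
Lemma below_large z : worse z -> e u z -> 64 <= #|below z|.
Proof.
move=> wz euz; have cz : ch z by rewrite /chain; apply/orP; right.
have [p [i [[pp lp up sp ip] _]]] := alternating_path cz.
have i0 : 0 < i.
  rewrite lt0n; apply/negP => /eqP i0; move: sp lp; rewrite i0 => /size0nil -> /= E.
  by move: euz; rewrite E e_irr.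
have uc : ucycle e (z :: p) by rewrite /ucycle up andbT /= rcons_path pp lp euz.
have H : 129 <= (2 * i).+1.
  rewrite -sp; apply: (girth (c := z :: p)) => //=; rewrite sp; first by lia.
  by rewrite mul2n odd_double.
by apply: leq_trans ip; lia.
Qed.

End OneVertex.

Variables (o : V -> V) (F : V -> V -> V) (T : nat).
Hypothesis o_edge : forall z, o z != z -> e z (o z).
Hypothesis sF : forall u, stable (del u e) rho M (F u).
Hypothesis TM : T <= M.

Definition hurt z := [&& o z != z, prk (F (o z)) z < T & T <= prk f z].

(** To each hurt [z] belong at least 64 chain vertices below it. They are matched in [f], and the
    sets of different hurt vertices are disjoint. *)
Lemma hurt_count : 64 * #|[set z | hurt z]| <= #|[set v | f v != v]|.
Proof.
pose C z := below (o z) (F (o z)) z.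
have wz z : hurt z -> worsened rho M (F (o z)) f z by move=> /and3P[_ a b]; apply: leq_trans a b.
have Clow z v : hurt z -> v \in C z -> prk f v < T.
  move=> h; rewrite inE => /andP[cv lt]; have /and3P[_ a _] := h; apply: leq_ltn_trans a.
  exact: (chain_mono rho_inj rho_lt (sF (o z)) sf cv (wz z h) lt).
(* From a common vertex both paths continue to the same best reply. Followed upwards they stay
   together until one reaches its end, which cannot lie inside the other path: by [Clow] it would
   have a partner below [T]. *)
have dis v z z' : hurt z -> hurt z' -> v \in C z -> v \in C z' -> z = z'.
  have [n] := ubnP (M - rho v); elim: n v => // n IH v; rewrite ltnS => vn h h' vz vz'.
  move: (vz) (vz'); rewrite !inE => /andP[cv lt] /andP[cv' lt'].
  have [w1 l1 le1 b1] := chain_step (sF (o z)) cv (wz _ h) lt.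
  have [w2 l2 le2 b2] := chain_step (sF (o z')) cv' (wz _ h') lt'.
  have E := best_reply_uniq b1 b2; rewrite -E in w2 l2 le2.
  set v1 := F (o z) (f v) in w1 l1 le1 w2 l2 le2.
  have inC y : worsened rho M (F (o y)) f v1 -> rho v1 <= rho y -> v1 = y \/ v1 \in C y.
    move=> w; rewrite leq_eqVlt => /orP[/eqP/rho_inj ->|l]; [by left|right].
    by rewrite inE /chain w orbT l.
  have top y : hurt y -> ~ (prk f y < T) by move=> /and3P[_ _ a]; rewrite ltnNge a.
  case: (inC z w1 le1) => [E1|i1]; case: (inC z' w2 le2) => [E2|i2].
  - by rewrite -E1 -E2.
  - by exfalso; apply: (top z h); rewrite -E1; apply: Clow h' i2.
  - by exfalso; apply: (top z' h'); rewrite -E2; apply: Clow h i1.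
  - by apply: (IH v1) => //; have := rho_lt v1; have := rho_lt v; lia.
rewrite mulnC -sum_nat_const.
apply: (@leq_trans (\sum_(z | hurt z) #|C z|)).
  rewrite (eq_bigl hurt) => [|z]; last by rewrite inE.
  apply: leq_sum => z h; have /and3P[oz _ _] := h.
  by apply: (below_large (sF (o z)) (wz z h)); rewrite e_sym; apply: o_edge.
have E z : #|C z| = \sum_v (v \in C z).
  by rewrite -sum1_card big_mkcond; apply: eq_bigr => v _; case: (v \in C z).
rewrite (eq_bigr _ (fun z _ => E z)) exchange_big /= -sum1_card [X in _ <= X]big_mkcond /=.
apply: leq_sum => v _.
case: (pickP [pred z | hurt z && (v \in C z)]) => [z0 /andP[h0 v0]|no].
  have -> : v \in [set v | f v != v].
    by rewrite inE -(prk_matched rho_lt) (leq_trans (Clow _ _ h0 v0)).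
  rewrite (bigD1 z0) //= v0 big1 ?addn0 // => z /andP[h nz]; case vz: (v \in C z) => //.
  by rewrite (dis v z z0 h h0 vz v0) eqxx in nz.
by rewrite big1 // => z h; move: (no z); rewrite /= h /= => ->.
Qed.

End OwnHurt.

Local Open Scope ring_scope.

(** * Pointwise inequalities *)

Section Pointwise.
Variable R : realFieldType.
Implicit Types a b p q s t T : R.

Definition posp (z : R) := Num.max 0 z.
(** The area bound of [hurt_level_sum] in units of [N], without its linear error. *)
Definition dmax a b := Num.min a b * Num.max a b - Num.min a b ^+ 2 / 2%:R.

Lemma pospP z : (posp z = z /\ 0 <= z) \/ (posp z = 0 /\ z <= 0).
Proof. by rewrite /posp; case: (leP 0 z) => h; [left|right]; split=> //; lra. Qed.

Lemma affine_ge (A B b b0 b1 c : R) : b0 <= b <= b1 ->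
  c <= A + B * b0 -> c <= A + B * b1 -> c <= A + B * b.
Proof.
move=> /andP[h0 h1] H0 H1; case: (leP 0 B) => hB.
  have := ler_wpM2l hB h0; lra.
have := ler_wnM2l (ltW hB) h1; lra.
Qed.

(** Multiplied by [2 * s ^+ 2 / 3], the subtracted minima become exactly the loss
    [(G - 1/3) * (min a s + min b s)], which is how [inner_term] uses the inequality. *)
Lemma inner_point s a b : 0 <= s -> s <= 1/2%:R -> 0 <= a -> a <= b -> b <= 1 ->
  5%:R * s ^+ 2 <= 3%:R * (a + b - a * b + a ^+ 2 / 2%:R + 2%:R * posp (s - a) * posp (s - b))
     - s * (Num.min a s + Num.min b s).
Proof.
move=> s0 s1 a0 ab b1.
have [sa|sa] := leP a s; last first.
  have E1 : posp (s - a) = 0 by rewrite /posp; apply/max_idPl; lra.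
  have -> : Num.min b s = s by apply/min_idPr; lra.
  rewrite E1; nra.
have [sb|sb] := leP b s; last first.
  have -> : posp (s - b) = 0 by rewrite /posp; apply/max_idPl; lra.
  have h : 0 <= (b - s) * (1 - a) by apply: mulr_ge0; lra.
  have h2 : 0 <= a * (3%:R - 4%:R * s) by apply: mulr_ge0; lra.
  have h3 : 0 <= s * (1 - 2%:R * s) by apply: mulr_ge0; lra.
  nra.
have -> : posp (s - b) = s - b by rewrite /posp; apply/max_idPr; lra.
have -> : posp (s - a) = s - a by rewrite /posp; apply/max_idPr; lra.
have h1 : 0 <= a * (b - a) by apply: mulr_ge0; lra.
have h2 : 0 <= (s - a) * (s - b) by apply: mulr_ge0; lra.
have h3 : 0 <= (s - b) * (1 - 2%:R * s) by apply: mulr_ge0; lra.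
have h4 : 0 <= (s - a) * (1 - 2%:R * s) by apply: mulr_ge0; lra.
have h5 : 0 <= a * (1 - 2%:R * s) by apply: mulr_ge0; lra.
have h6 : 0 <= b * (1 - 2%:R * s) by apply: mulr_ge0; lra.
nra.
Qed.

(* The bounds on c hold for c = G/P, P = 2 s^2, G = (1 + 2 s^3) / 3. *)
Lemma outer_point c s T p q :
  1/2%:R <= c -> 3%:R * (1 - s) <= 2%:R * c -> 5%:R/6%:R <= c \/ 1/2%:R <= s ->
  0 <= T -> T <= 1/2%:R -> T <= s -> s <= 1 -> 0 <= p -> p <= T -> 0 <= q -> q <= 1 ->
  1 + T ^+ 2 / 2%:R + c * (1 - T) <=
  p + q - dmax p q + posp (s - p) * posp (s - q) + (1 - q) * (s - T)
    + posp (s - q) * (T - p) + c * (2%:R - p - q).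
Proof.
move=> c0 c1 c2 T0 T1 Ts s1 p0 pT q0 q1.
have E : posp (s - p) = s - p by rewrite /posp; apply/max_idPr; lra.
(* The right side is affine in [q] on [[p, s]] and on [[s, 1]], and for [q < p] affine in [p] on
   [[q, T]]. Only the ends of these ranges need a check; this is the end [p = q]. There is equality
   at [p = T], [q = 1]. *)
have diag x : 0 <= x -> x <= T ->
  1 + T ^+ 2 / 2%:R + c * (1 - T) <=
  x + x - (x * x - x ^+ 2 / 2%:R) + (s - x) * (s - x) + (1 - x) * (s - T)
    + (s - x) * (T - x) + c * (2%:R - x - x).
  move=> x0 xT.
  have h1 : 0 <= x * (T - x) by apply: mulr_ge0; lra.
  have h2 : 0 <= (c - 1/2%:R) * (1 - x - x) by apply: mulr_ge0; lra.
  have h3 : 0 <= (2%:R * c - 3%:R * (1 - s)) * (1 - x - x) by apply: mulr_ge0; lra.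
  have h4 : 0 <= (c - 1/2%:R) * T by apply: mulr_ge0; lra.
  have h5 : 0 <= (2%:R * c - 3%:R * (1 - s)) * T by apply: mulr_ge0; lra.
  have h6 : 0 <= (s - T) * (1 - s) by apply: mulr_ge0; lra.
  have h7 : 0 <= (1/2%:R - T) * (1 - s) by apply: mulr_ge0; lra.
  have h8 : 0 <= (1/2%:R - T) * T by apply: mulr_ge0; lra.
  have h9 : 0 <= (1/2%:R - x) * x by apply: mulr_ge0; lra.
  have h10 : 0 <= (s - T) * (1 / 2%:R - x) by apply: mulr_ge0; lra.
  case: c2 => c2; first by nra.
  nra.
have [pq|qp] := leP p q.
  have -> : dmax p q = p * q - p ^+ 2 / 2%:R by rewrite /dmax (min_idPl pq) (max_idPr pq).
  have key : 1 + T ^+ 2 / 2%:R + c * (1 - T) <=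
     p + s - (p * s - p ^+ 2 / 2%:R) + (1 - s) * (s - T) + c * (2%:R - p - s).
    have h1 : 0 <= (c - 1/2%:R) * (T - p) by apply: mulr_ge0; lra.
    have h2 : 0 <= (1 - s) * (2%:R * c - 3%:R * (1 - s)) by apply: mulr_ge0; lra.
    have h3 : 0 <= (1/2%:R - T) * (T - p) by apply: mulr_ge0; lra.
    have h4 := sqr_ge0 (1 - s - (T - p)).
    nra.
  have [qs|sq] := leP q s.
    have -> : posp (s - q) = s - q by rewrite /posp; apply/max_idPr; lra.
    rewrite E.
    pose B := 1 - p - (s - p) - (s - T) - (T - p) - c.
    have := @affine_ge (p + p ^+ 2 / 2%:R + (s - p) * s + (s - T) + s * (T - p) + c * (2%:R - p)) B q p s.
    move=> H; apply: le_trans (H _ _ _ _) _.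
    + by rewrite pq qs.
    + by apply: le_trans (diag p p0 pT) _; rewrite /B; lra.
    + by apply: le_trans key _; rewrite /B; lra.
    + by rewrite /B; lra.
  have -> : posp (s - q) = 0 by rewrite /posp; apply/max_idPl; lra.
  pose B := 1 - p - (s - T) - c.
  have := @affine_ge (p + p ^+ 2 / 2%:R + (s - T) + c * (2%:R - p)) B q s 1.
  move=> H; apply: le_trans (H _ _ _ _) _.
  + by rewrite q1 (ltW sq).
  + by apply: le_trans key _; rewrite /B; lra.
  + have h1 : 0 <= (c - 1/2%:R) * (T - p) by apply: mulr_ge0; lra.
    have h3 : 0 <= (1 - T - p) * (T - p) by apply: mulr_ge0; lra.
    rewrite /B; nra.
  + by rewrite /B; lra.
have -> : dmax p q = q * p - q ^+ 2 / 2%:R by rewrite /dmax (min_idPr (ltW qp)) (max_idPl (ltW qp)).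
have -> : posp (s - q) = s - q by rewrite /posp; apply/max_idPr; lra.
rewrite E.
pose B := 1 - q - (s - q) - (s - q) - c.
have := @affine_ge (q + q ^+ 2 / 2%:R + s * (s - q) + (1 - q) * (s - T) + (s - q) * T + c * (2%:R - q)) B p q T.
move=> H; apply: le_trans (H _ _ _ _) _.
+ by rewrite pT (ltW qp).
+ apply: le_trans (diag q q0 _) _; first by lra.
  by rewrite /B; lra.
+ have h1 : 0 <= (c - 1/2%:R) * (1 - q) by apply: mulr_ge0; lra.
  have h2 : 0 <= (2%:R * c - 3%:R * (1 - s)) * (1 - q) by apply: mulr_ge0; lra.
  have h3 : 0 <= (s - T) * (1 - s) by apply: mulr_ge0; lra.
  have h4 : 0 <= (1/2%:R - T) * (1 - s) by apply: mulr_ge0; lra.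
  have h5 : 0 <= (1/2%:R - q) * q by apply: mulr_ge0; lra.
  have h6 : 0 <= (T - q) * q by apply: mulr_ge0; lra.
  have h7 : 0 <= (s - T) * (1/2%:R - q) by apply: mulr_ge0; lra.
  rewrite /B; case: c2 => c2; nra.
+ by rewrite /B; lra.
Qed.

(** At [b = 1] the right side without truncation is [1 + a ^+ 2 / 2 + c * (1 - a)], least at
    [a = c]. The term [E] pays for the possible deficit at [b = s]; in between, the expression is
    affine in [b]. *)
Lemma free_point c s a b E :
  1/2%:R <= c -> 3%:R * (1 - s) <= 2%:R * c -> c <= 7%:R/6%:R - 2%:R/3%:R * s ->
  1/2%:R <= s -> s <= 1 -> 0 <= E -> (1 - s) * ((3%:R - s) / 2%:R - 2%:R * c) <= E ->
  0 <= a -> a <= b -> b <= 1 ->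
  1 + c - c ^+ 2 / 2%:R - E <=
  a + b - a * b + a ^+ 2 / 2%:R + 2%:R * posp (s - a) * posp (s - b) + c * (2%:R - a - b).
Proof.
move=> c0 c1 c2 s0 s1 E0 hE a0 ab b1.
have at1 x : 1 + c - c ^+ 2 / 2%:R - E <= 1 + x ^+ 2 / 2%:R + c * (1 - x).
  have := sqr_ge0 (x - c); lra.
have ats x : 1 + c - c ^+ 2 / 2%:R - E <=
    x + s - x * s + x ^+ 2 / 2%:R + c * (2%:R - x - s).
  have := sqr_ge0 (x - (c - (1 - s))); lra.
have [sb|sb] := leP b s; last first.
  have -> : posp (s - b) = 0 by rewrite /posp; apply/max_idPl; lra.
  pose B := 1 - a - c.
  have H := @affine_ge (a + a ^+ 2 / 2%:R + c * (2%:R - a)) B b (Num.max a s) 1.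
  apply: le_trans (H (1 + c - c ^+ 2 / 2%:R - E) _ _ _) _.
  + by rewrite b1 andbT ge_max ab (ltW sb).
  + rewrite /B; case: (leP a s) => as_; first by apply: le_trans (ats a) _; lra.
    have h : 0 <= (a - s) * (1 - a) by apply: mulr_ge0; lra.
    have := ats s; have := at1 1; nra.
  + by apply: le_trans (at1 a) _; rewrite /B; lra.
  + by rewrite /B; lra.
have -> : posp (s - b) = s - b by rewrite /posp; apply/max_idPr; lra.
have -> : posp (s - a) = s - a by rewrite /posp; apply/max_idPr; lra.
pose B := 1 - a - 2%:R * (s - a) - c.
have H := @affine_ge (a + a ^+ 2 / 2%:R + 2%:R * (s - a) * s + c * (2%:R - a)) B b a s.
apply: le_trans (H (1 + c - c ^+ 2 / 2%:R - E) _ _ _) _.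
+ by rewrite ab sb.
(* The subtracted value is the minimiser of the right side on the diagonal [a = b]. *)
+ have := sqr_ge0 (a - (c + 2%:R * s - 1) / 3%:R * 2%:R).
  have h1 : 0 <= (c - 1/2%:R) * (1 - s) by apply: mulr_ge0; lra.
  have h2 : 0 <= (c - 1/2%:R) * (s - 1/2%:R) by apply: mulr_ge0; lra.
  have h3 : 0 <= (c - 1/2%:R) * (7%:R/6%:R - 2%:R/3%:R * s - c) by apply: mulr_ge0; lra.
  have h4 : 0 <= (2%:R * c - 3%:R * (1 - s)) * (1 - s) by apply: mulr_ge0; lra.
  have h5 : 0 <= (s - 1/2%:R) * (1 - s) by apply: mulr_ge0; lra.
  rewrite /B; nra.
+ by apply: le_trans (ats a) _; rewrite /B; lra.
+ by rewrite /B; lra.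
Qed.
End Pointwise.

(** * Power sums *)

Section PowerSums.
Variable R : realFieldType.

Lemma pow_diff_bounds (j : nat) (s h : R) : 0 <= s -> 0 <= h ->
  j.+1%:R * h * s ^+ j <= (s + h) ^+ j.+1 - s ^+ j.+1 <= j.+1%:R * h * (s + h) ^+ j.
Proof.
move=> s0 h0; have sh : s <= s + h by rewrite lerDl.
rewrite subrXX addrAC subrr add0r -[j.+1%:R * h]mulrC -!mulrA.
have E c : j.+1%:R * c = \sum_(i < j.+1) c :> R by rewrite sumr_const card_ord mulr_natl.
rewrite !E; apply/andP; split; apply: ler_wpM2l => //; apply: ler_sum => i _.
  rewrite /= (_ : s ^+ j = s ^+ (j - i) * s ^+ i) ; last by rewrite -exprD subnK ?leq_ord.
  by apply: ler_wpM2r; rewrite ?exprn_ge0 // lerXn2r ?nnegrE // addr_ge0.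
rewrite /= (_ : (s + h) ^+ j = (s + h) ^+ (j - i) * (s + h) ^+ i) ; last by rewrite -exprD subnK ?leq_ord.
by apply: ler_wpM2l; rewrite ?exprn_ge0 ?addr_ge0 // lerXn2r ?nnegrE // addr_ge0.
Qed.

Definition frac (N k : nat) : R := k%:R / N%:R.

(** A left Riemann sum of the power [j]. It lies below the integral, and the right sum exceeds it by
    at most one step, because the end values lie in [[0, 1]]. *)
Lemma power_sum (N a b j : nat) : (0 < N)%N -> (a <= b <= N)%N ->
  frac N b ^+ j.+1 / j.+1%:R - frac N a ^+ j.+1 / j.+1%:R - N%:R^-1
  <= \sum_(a <= k < b) N%:R^-1 * frac N k ^+ j
  <= frac N b ^+ j.+1 / j.+1%:R - frac N a ^+ j.+1 / j.+1%:R.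
Proof.
rewrite /frac => N0 /andP[ab bN]; set h : R := N%:R^-1.
have h0 : 0 <= h by rewrite invr_ge0.
have NR0 : N%:R != 0 :> R by rewrite pnatr_eq0 -lt0n.
have step k : k.+1%:R / N%:R = k%:R / N%:R + h :> R by rewrite -natr1 mulrDl mul1r.
have j0 : 0 < j.+1%:R :> R by rewrite ltr0n.
have s0 k : 0 <= k%:R / N%:R :> R by rewrite divr_ge0.
have bd k : h * (k%:R / N%:R) ^+ j <= (k.+1%:R / N%:R) ^+ j.+1 / j.+1%:R - (k%:R / N%:R) ^+ j.+1 / j.+1%:R
    <= h * (k.+1%:R / N%:R) ^+ j.
  have /andP[l u] := pow_diff_bounds j (s0 k) h0.
  rewrite step -mulrBl ler_pdivlMr // ler_pdivrMr //.
  apply/andP; split.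
    by apply: le_trans l; rewrite le_eqVlt; apply/orP; left; apply/eqP; ring.
  by apply: le_trans u _; rewrite le_eqVlt; apply/orP; left; apply/eqP; ring.
have tel (F : nat -> R) : \sum_(a <= k < b) (F k.+1 - F k) = F b - F a by rewrite telescope_sumr.
rewrite -(tel (fun k => (k%:R / N%:R) ^+ j.+1 / j.+1%:R)).
apply/andP; split; last by apply: ler_sum => k _; case/andP: (bd k).
have E : \sum_(a <= k < b) (h * (k.+1%:R / N%:R) ^+ j - h * (k%:R / N%:R) ^+ j) <= h.
  rewrite (tel (fun k => h * (k%:R / N%:R) ^+ j)).
  have : (b%:R / N%:R) ^+ j <= 1 :> R.
    by rewrite exprn_ile1 // ler_pdivrMr ?ltr0n // mul1r ler_nat.
  have : 0 <= (a%:R / N%:R) ^+ j :> R by rewrite exprn_ge0.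
  by move=> x y; have := ler_wpM2l h0 y; have := mulr_ge0 h0 x; lra.
have : \sum_(a <= k < b) ((k.+1%:R / N%:R) ^+ j.+1 / j.+1%:R - (k%:R / N%:R) ^+ j.+1 / j.+1%:R)
   <= \sum_(a <= k < b) h * (k.+1%:R / N%:R) ^+ j :> R.
  by apply: ler_sum => k _; case/andP: (bd k).
move: E; rewrite sumrB; lra.
Qed.
End PowerSums.

(** * Summation over levels *)

Section RealAssembly.
Variables (R : realFieldType) (n : nat).
Hypothesis n0 : (0 < n)%N.
(** An even [N] makes the level 1/2, where the case distinctions take place, a grid point. *)
Let N := n.*2.
Variables (F P Q dA dB : nat -> nat).
Hypotheses (P_le : forall t, (P t <= N)%N) (Q_le : forall t, (Q t <= N)%N).
Hypothesis P_mono : forall t, (t <= N)%N -> (P t <= P N)%N.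
Hypothesis lsym : forall t, (t <= N)%N ->
  (2 * F t + 4 * ((t - P t) * (t - Q t)) + minn (P t) (Q t) ^ 2
  <= 2 * (P t * Q t) + 2 * ((N - P t) * N) + 2 * ((N - Q t) * N) + 5 * N)%N.
Hypothesis lT : forall t, (t <= N)%N -> (P N <= t)%N ->
  (2 * F t + 2 * ((t - P t) * (t - Q t)) + 2 * ((t - Q t) * (P N - P t)) + minn (P t) (Q t) ^ 2
  <= 2 * (P t * Q t) + 2 * ((N - P t) * N) + 2 * ((N - Q t) * (N - (t - P N))) + 5 * N)%N.
Hypotheses (dA_cap : forall k, (k < N)%N -> (dA k <= Q k.+1)%N).
Hypotheses (dB_cap : forall k, (k < N)%N -> (dB k <= P k.+1)%N).
Hypotheses (dA_diag : forall k, (k < P N)%N -> (dA k <= k.+1)%N).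
Hypotheses (dB_diag : forall k, (k < P N)%N -> (dB k <= k.+1)%N).
Hypothesis sq : forall m, (m <= P N)%N -> (2 * (\sum_(k < m) (dB k + dA k)) <= m * m.+1 + 4 * N)%N.

Local Notation NR := (N%:R : R).
Local Notation h := (N%:R^-1 : R).
Local Notation fr := (frac R N).
Definition cubicG (k : nat) : R := (1 + 2%:R * fr k ^+ 3) / 3%:R.
Local Notation G := cubicG.
Definition cubicW (k : nat) : R := G k.+1 - G k.
Local Notation w := cubicW.

Let N0 : (0 < N)%N. Proof. by rewrite double_gt0. Qed.
Let NR0 : 0 < NR. Proof. by rewrite ltr0n. Qed.
Let h0 : 0 < h. Proof. by rewrite invr_gt0. Qed.
Let Nh : NR * h = 1. Proof. by rewrite mulfV // gt_eqF. Qed.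
Let fr0 k : 0 <= fr k. Proof. by rewrite divr_ge0 ?ler0n. Qed.
Let fr1 k : (k <= N)%N -> fr k <= 1. Proof. by move=> kN; rewrite ler_pdivrMr // mul1r ler_nat. Qed.
Let frS k : fr k.+1 = fr k + h. Proof. by rewrite /frac -natr1 mulrDl mul1r. Qed.
Let frN : fr N = 1. Proof. by rewrite /frac mulfV // gt_eqF. Qed.
Let frle j k : (j <= k)%N -> fr j <= fr k.
Proof. by move=> jk; rewrite ler_pM2r // ler_nat. Qed.
Let frE k : k%:R = NR * fr k. Proof. by rewrite mulrC divfK // gt_eqF. Qed.
Let frhalf : fr n = 1/2%:R.
Proof. by rewrite /frac /N -muln2 natrM; field; rewrite pnatr_eq0 -lt0n n0. Qed.

Let nat2E m : (2 * m)%:R = 2%:R * m%:R :> R. Proof. exact: natrM. Qed.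
Let nat4E m : (4 * m)%:R = 4%:R * m%:R :> R. Proof. exact: natrM. Qed.

Lemma posp_ge0 (z : R) : 0 <= posp z. Proof. by rewrite le_max lexx. Qed.

Lemma sub_posp k p : NR * posp (fr k - fr p) <= (k.+1 - p)%N%:R.
Proof.
have [[-> _]|[-> _]] := pospP (fr k - fr p); last by rewrite mulr0.
rewrite mulrBr -!frE; case: (leqP p k.+1) => pk; first by rewrite natrB // -natr1; lra.
rewrite (eqP (ltnW pk : (k.+1 - p == 0)%N)).
have : k%:R <= p%:R :> R by rewrite ler_nat; lia.
lra.
Qed.

Lemma min_frac p q : (minn p q)%:R = NR * Num.min (fr p) (fr q).
Proof.
case: (leqP p q) => [/frle|/ltnW/frle] le; first by rewrite (min_idPl le) -frE.
by rewrite (min_idPr le) -frE.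
Qed.

Lemma dmaxE a b : dmax a b = a * b - Num.min a b ^+ 2 / 2%:R :> R.
Proof. by rewrite /dmax; case: (leP a b) => //; rewrite mulrC. Qed.

Let prod_posp k p q : NR ^+ 2 * (posp (fr k - fr p) * posp (fr k - fr q)) <=
  ((k.+1 - p) * (k.+1 - q))%N%:R.
Proof.
have a := sub_posp k p; have b := sub_posp k q.
rewrite natrM expr2 mulrACA; apply: ler_pM => //; apply: mulr_ge0; rewrite ?posp_ge0 // ltW //.
Qed.

Lemma scale_le (x y z : R) : NR ^+ 2 * x - 5%:R/2%:R * NR <= 2%:R * NR ^+ 2 - z ->
  x - 5%:R/2%:R * h <= 2%:R - z * h ^+ 2.
Proof.
move=> H; have N2 : 0 < NR ^+ 2 by rewrite exprn_gt0.
rewrite -(ler_pM2l N2).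
have -> : NR ^+ 2 * (x - 5%:R/2%:R * h) = NR ^+ 2 * x - 5%:R/2%:R * NR * (NR * h) by ring.
have -> : NR ^+ 2 * (2%:R - z * h ^+ 2) = 2%:R * NR ^+ 2 - z * (NR * h) ^+ 2 by ring.
by rewrite Nh expr1n !mulr1.
Qed.

(** This is [lsym] divided by [2 * N ^+ 2]. Levels are taken at [k.+1] but measured by [fr k], which
    only weakens the bound and removes rounding in the truncated differences. *)
Lemma succ_sym k : (k < N)%N -> let a := fr (P k.+1) in let b := fr (Q k.+1) in let s := fr k in
  a + b - dmax a b + 2%:R * (posp (s - a) * posp (s - b)) - 5%:R/2%:R * h
  <= 2%:R - (F k.+1)%:R * h ^+ 2.
Proof.
move=> kN; cbv zeta; set a := fr (P k.+1); set b := fr (Q k.+1); set s := fr k; apply: scale_le => //.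
have H := lsym kN; rewrite -(ler_nat R) !(natrD, nat2E, nat4E) in H.
have e := prod_posp k (P k.+1) (Q k.+1).
rewrite natrX min_frac in H; rewrite dmaxE.
rewrite [(P k.+1 * _)%:R]natrM [((N - P k.+1) * N)%:R]natrM [((N - Q k.+1) * N)%:R]natrM !natrB ?P_le ?Q_le // !(frE (P k.+1)) !(frE (Q k.+1)) -/a -/b in H.
rewrite -/a -/b -/s in e H; nra.
Qed.

Lemma succ_T k : (k < N)%N -> (P N <= k)%N ->
  let a := fr (P k.+1) in let b := fr (Q k.+1) in let s := fr k in let T := fr (P N) in
  a + b - dmax a b + posp (s - a) * posp (s - b) + (1 - b) * (s - T) + posp (s - b) * (T - a)
   - 5%:R/2%:R * h <= 2%:R - (F k.+1)%:R * h ^+ 2.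
Proof.
move=> kN Tk; cbv zeta; set a := fr (P k.+1); set b := fr (Q k.+1); set s := fr k; set T := fr (P N); apply: scale_le => //.
have H := lT kN (leqW Tk); rewrite -(ler_nat R) !(natrD, nat2E) in H.
have e := prod_posp k (P k.+1) (Q k.+1).
have aT : fr (P k.+1) <= T by apply/frle/P_mono.
have e2 : NR ^+ 2 * (posp (s - b) * (T - a)) <= ((k.+1 - Q k.+1) * (P N - P k.+1))%:R.
  rewrite natrM expr2 mulrACA; apply: ler_pM.
  - by rewrite mulr_ge0 ?posp_ge0 // ltW.
  - by rewrite mulr_ge0 ?subr_ge0 // ltW.
  - exact: sub_posp.
  - by rewrite natrB ?P_mono // (frE (P N)) (frE (P k.+1)) mulrBr.
rewrite natrX min_frac in H; rewrite dmaxE.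
have e3 : ((N - Q k.+1) * (N - (k.+1 - P N)))%:R <= NR ^+ 2 * ((1 - b) * (1 - (s - T))).
  rewrite natrM !natrB ?Q_le ?(leqW Tk) //; last by lia.
  rewrite (frE (Q k.+1)) (frE k.+1) (frE (P N)) frS -/b -/s -/T expr2 mulrACA; apply: ler_pM.
  - by have := ler_wpM2l (ltW NR0) (fr1 (Q_le k.+1)); rewrite -/b; lra.
  - have : s + h <= 1 by rewrite -frS; apply: fr1.
    move/(ler_wpM2l (ltW NR0)); have := mulr_ge0 (ltW NR0) (fr0 (P N)); rewrite -/T; lra.
  - by lra.
  - have := mulr_ge0 (ltW NR0) (ltW h0); lra.
rewrite [(P k.+1 * _)%:R]natrM [((N - P k.+1) * N)%:R]natrM natrB ?P_le // !(frE (P k.+1)) !(frE (Q k.+1)) -/a -/b in H.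
rewrite -/a -/b -/s in e e2 e3 H; nra.
Qed.

Lemma cubicW_ge k : 2%:R * fr k ^+ 2 * h <= w k.
Proof.
rewrite /w /G frS; have := fr0 k; set s := fr k => s0.
have : 0 <= s * h ^+ 2 by rewrite mulr_ge0 ?exprn_ge0 // ltW.
have : 0 <= h ^+ 3 by rewrite exprn_ge0 // ltW.
lra.
Qed.

Lemma cubicW_ge0 k : 0 <= w k.
Proof. by apply: le_trans (cubicW_ge k); rewrite !mulr_ge0 ?exprn_ge0 // ltW. Qed.

Lemma cubicG_ge k : 1/3%:R <= G k.
Proof. rewrite /G; have : 0 <= fr k ^+ 3 by rewrite exprn_ge0. lra. Qed.

(** The share of [k] in the average gain of the two ends: the increment of [G] times the success
    density at level [k.+1], plus the reward [G k] of an end of rank [k] for being matched at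
    all. *)
Definition levelterm k : R :=
  w k * (2%:R - (F k.+1)%:R * h ^+ 2) + h * G k * (2%:R - (dA k + dB k)%:R * h).

Let term_ge k (S D X : R) : (k < N)%N -> 0 <= S -> S - 5%:R/2%:R * h <= 2%:R - (F k.+1)%:R * h ^+ 2 ->
  h * G k * (2%:R - (dA k + dB k)%:R * h) >= h * D ->
  X <= 2%:R * fr k ^+ 2 * S + D ->
  h * X - 5%:R/2%:R * h * w k <= levelterm k.
Proof.
move=> kN S0 HS HD HX; rewrite /levelterm.
have a1 := ler_wpM2l (cubicW_ge0 k) HS.
have a2 := ler_wpM2r S0 (cubicW_ge k).
have a3 := ler_wpM2l (ltW h0) HX.
lra.
Qed.

Let S_ge0 k : (k < N)%N -> let a := fr (P k.+1) in let b := fr (Q k.+1) in 0 <= a + b - dmax a b.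
Proof.
move=> kN; cbv zeta; set a := fr (P k.+1); set b := fr (Q k.+1); rewrite dmaxE.
have a0 : 0 <= a := fr0 _; have b0 : 0 <= b := fr0 _.
have b1 : b <= 1 := fr1 (Q_le _).
have : 0 <= a * (1 - b) by apply: mulr_ge0; lra.
have := sqr_ge0 (Num.min a b); lra.
Qed.

(** The loss [G k * (dA k + dB k)] is split. The part with the constant 1/3 is kept for [sq], which
    bounds it well only after summation; the rest is bounded by the minima and cancels through
    [inner_point]. *)
Lemma inner_term k : (k < P N)%N -> (k < n)%N ->
  h * (2%:R * G k + 10%:R/3%:R * fr k ^+ 4) - 5%:R/2%:R * h * w k
    - (dA k + dB k)%:R * h ^+ 2 / 3%:R - 2%:R * h ^+ 2 <= levelterm k.
Proof.
move=> kP kn; have kN : (k < N)%N by apply: leq_trans kP (P_le _).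
set a := fr (P k.+1); set b := fr (Q k.+1); set s := fr k.
have s0 : 0 <= s := fr0 _.
have s1 : s <= 1/2%:R by rewrite -frhalf; apply/frle/ltnW.
have a0 : 0 <= a := fr0 _; have b0 : 0 <= b := fr0 _.
have a1 : a <= 1 := fr1 (P_le _); have b1 : b <= 1 := fr1 (Q_le _).
have dle (d : nat) c : (d <= c)%N -> (d <= k.+1)%N -> d%:R * h <= Num.min (fr c) s + h.
  move=> d1 d2; have : d%:R * h <= fr c by rewrite ler_pM2r // ler_nat.
  have : d%:R * h <= s + h by rewrite -frS ler_pM2r // ler_nat.
  by case: (leP (fr c) s) => _; have := ltW h0; lra.
have hA := dle _ _ (dA_cap kN) (dA_diag kP).
have hB := dle _ _ (dB_cap kN) (dB_diag kP).
rewrite -/a -/b in hA hB.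
have G3 := cubicG_ge k.
have GE : G k - 1/3%:R = 2%:R * s ^+ 3 / 3%:R by rewrite /G -/s; lra.
have pt : 5%:R * s ^+ 2 <= 3%:R * (a + b - dmax a b + 2%:R * (posp (s - a) * posp (s - b)))
     - s * (Num.min a s + Num.min b s).
  rewrite /dmax mulrA; case: (leP a b) => ab; first by apply: le_trans (inner_point s0 s1 a0 ab b1) _; lra.
  by apply: le_trans (inner_point s0 s1 b0 (ltW ab) a1) _; rewrite [X in _ <= X - _]mulrC; lra.
set S := a + b - dmax a b + 2%:R * (posp (s - a) * posp (s - b)) in pt.
have S0 : 0 <= S by rewrite /S; have := S_ge0 kN; have := mulr_ge0 (posp_ge0 (s - a)) (posp_ge0 (s - b)); rewrite /= -/a -/b; lra.
have s2 : 0 <= 2%:R * s ^+ 2 / 3%:R by have := sqr_ge0 s; lra.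
set d : R := (dA k + dB k)%:R * h.
have dE : d <= Num.min a s + Num.min b s + 2%:R * h by rewrite /d natrD mulrDl; lra.
have G13 : 0 <= G k - 1/3%:R by lra.
have G13' : G k - 1/3%:R <= 1.
  have : s ^+ 3 <= 1 by rewrite exprn_ile1 //; lra.
  lra.
have T := @term_ge k S (2%:R * G k - (G k - 1/3%:R) * (Num.min a s + Num.min b s) - d / 3%:R - 2%:R * h)
   (2%:R * G k + 10%:R/3%:R * s ^+ 4 - d / 3%:R - 2%:R * h) kN S0 (succ_sym kN) _ _.
apply: le_trans (T _ _).
- rewrite -/d -mulrA; have -> : (dA k + dB k)%:R * h ^+ 2 = d * h by rewrite /d; ring.
  by rewrite -/s; lra.
- rewrite -/d -mulrA ler_pM2l //.
  have := ler_wpM2l G13 dE; have := ler_wpM2r (ltW h0) G13'; lra.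
- have := ler_wpM2l s2 pt; rewrite GE -/s; lra.
Qed.

(** The ratio of [G] to its derivative [2 * s ^+ 2], that is, the parameter [c] of the pointwise
    inequalities. *)
Let cc (s : R) := (1 + 2%:R * s ^+ 3) / (6%:R * s ^+ 2).

Let cc_G k : 0 < fr k -> 2%:R * fr k ^+ 2 * cc (fr k) = G k.
Proof. by move=> s0; rewrite /cc /G; field; rewrite gt_eqF. Qed.

Let outerD k : (k < N)%N ->
  h * G k * (2%:R - (dA k + dB k)%:R * h) >= h * (G k * (2%:R - fr (P k.+1) - fr (Q k.+1))).
Proof.
move=> kN; rewrite -mulrA ler_pM2l // ler_wpM2l //; first by have := cubicG_ge k; lra.
have : (dA k)%:R * h <= fr (Q k.+1) by rewrite ler_pM2r // ler_nat dA_cap.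
have : (dB k)%:R * h <= fr (P k.+1) by rewrite ler_pM2r // ler_nat dB_cap.
rewrite natrD mulrDl; lra.
Qed.

Let cc_half (s : R) : 0 < s -> s <= 1 -> 1/2%:R <= cc s.
Proof.
move=> s0 s1; rewrite /cc ler_pdivlMr ?mulr_gt0 ?exprn_gt0 //.
have : 0 <= (1 - s) ^+ 2 * (1 + 2%:R * s) by rewrite mulr_ge0 ?sqr_ge0 //; lra.
lra.
Qed.

Let cc_lin (s : R) : 0 < s -> s <= 1 -> 3%:R * (1 - s) <= 2%:R * cc s.
Proof.
move=> s0 s1; rewrite /cc mulrA ler_pdivlMr ?mulr_gt0 ?exprn_gt0 //.
(* The claim is [1 - 9 * s ^+ 2 + 11 * s ^+ 3 >= 0], whose left side is least at 6/11. *)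
have : 0 <= s * (s - 6%:R/11%:R) ^+ 2 by rewrite mulr_ge0 ?sqr_ge0 //; lra.
have : 0 <= (s - 6%:R/11%:R) ^+ 2 by rewrite sqr_ge0.
lra.
Qed.

Lemma outer_term k : (k < N)%N -> (P N <= k)%N -> (P N <= n)%N -> let T := fr (P N) in
  h * (2%:R * fr k ^+ 2 * (1 + T ^+ 2 / 2%:R) + G k * (1 - T)) - 5%:R/2%:R * h * w k <= levelterm k.
Proof.
move=> kN Tk Tn; cbv zeta; set T := fr (P N).
set a := fr (P k.+1); set b := fr (Q k.+1); set s := fr k.
have T0 : 0 <= T := fr0 _; have T1 : T <= 1/2%:R by rewrite -frhalf; apply: frle.
have Ts : T <= s by apply: frle.
have s1 : s <= 1 by apply/fr1/ltnW.
have a0 : 0 <= a := fr0 _; have b0 : 0 <= b := fr0 _; have b1 : b <= 1 := fr1 (Q_le _).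
have aT : a <= T by apply/frle/P_mono.
set S := a + b - dmax a b + posp (s - a) * posp (s - b) + (1 - b) * (s - T) + posp (s - b) * (T - a).
have S0 : 0 <= S.
  have := S_ge0 kN; rewrite /= -/a -/b.
  have := mulr_ge0 (posp_ge0 (s - a)) (posp_ge0 (s - b)).
  have : 0 <= (1 - b) * (s - T) by apply: mulr_ge0; lra.
  have : 0 <= posp (s - b) * (T - a) by apply: mulr_ge0; rewrite ?posp_ge0 //; lra.
  rewrite /S; lra.
apply: (term_ge kN S0 (succ_T kN Tk) (outerD kN)).
rewrite -/a -/b -/s.
have [s0|s0] := ltP 0 s; last first.
  have sE : s = 0 by have : 0 <= s := fr0 _; lra.
  have GE : G k = 1/3%:R by rewrite /G -/s sE expr0n /=; lra.
  rewrite sE expr0n /= mulr0 !mul0r GE; lra.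
have cE := cc_G s0; rewrite -/s in cE.
have s2 : 0 <= 2%:R * s ^+ 2 by have := sqr_ge0 s; lra.
have c5 : 5%:R/6%:R <= cc s \/ 1/2%:R <= s.
  have [hs|hs] := leP (1/2%:R) s; [by right|left].
  rewrite /cc ler_pdivlMr; last by have := exprn_gt0 2 s0; lra.
  have d1 : 0 <= (1 - 2%:R * s) * s by apply: mulr_ge0; lra.
  have d2 : 0 <= (1 - 2%:R * s) * s * (1 - s) by apply: mulr_ge0; lra.
  lra.
have := ler_wpM2l s2 (outer_point (cc_half s0 s1) (cc_lin s0 s1) c5 T0 T1 Ts s1 a0 aT b0 b1).
rewrite -/S -cE; lra.
Qed.

(** A polynomial lower bound for [2 * s ^+ 2] times the left side of [free_point], with [1 / s ^+ 2]
    replaced by a quadratic majorant so that it can be summed by [power_sum]. *)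
Definition freepoly (s : R) := 2%:R * s ^+ 2 + (1 + 2%:R * s ^+ 3) / 3%:R
  - ((219%:R/16%:R - 845%:R/32%:R * s + 225%:R/16%:R * s ^+ 2) / 36%:R + s / 9%:R + s ^+ 4 / 9%:R)
  - (1 - s) ^+ 2 * (2%:R * s - 1) ^+ 2.

Lemma free_term k : (k < N)%N -> (n <= k)%N ->
  h * freepoly (fr k) - 5%:R/2%:R * h * w k <= levelterm k.
Proof.
move=> kN nk.
set a := fr (P k.+1); set b := fr (Q k.+1); set s := fr k.
have sh : 1/2%:R <= s by rewrite -frhalf; apply: frle.
have s1 : s <= 1 by apply/fr1/ltnW.
have s0 : 0 < s by lra.
have a0 : 0 <= a := fr0 _; have b0 : 0 <= b := fr0 _.
have a1 : a <= 1 := fr1 (P_le _); have b1 : b <= 1 := fr1 (Q_le _).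
have cE := cc_G s0; rewrite -/s in cE.
have s2 : 0 < 2%:R * s ^+ 2 by have := exprn_gt0 2 s0; lra.
(* This choice turns the requirement on [E] into [(1 - s) ^+ 4 >= 0] up to a positive factor. *)
set E := (1 - s) ^+ 2 * (2%:R * s - 1) ^+ 2 / (2%:R * s ^+ 2).
have E0 : 0 <= E by apply: divr_ge0; [apply: mulr_ge0; exact: sqr_ge0 | exact: ltW].
have c3 : cc s <= 7%:R/6%:R - 2%:R/3%:R * s.
  rewrite /cc ler_pdivrMr; last by have := exprn_gt0 2 s0; lra.
  have : 0 <= (1 - s) * (2%:R * s - 1) * (3%:R * s + 1) by apply: mulr_ge0; [apply: mulr_ge0|]; lra.
  lra.
have hE : (1 - s) * ((3%:R - s) / 2%:R - 2%:R * cc s) <= E.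
  rewrite /E ler_pdivlMr //.
  have -> : (1 - s) * ((3%:R - s) / 2%:R - 2%:R * cc s) * (2%:R * s ^+ 2)
    = (1 - s) * ((3%:R - s) * s ^+ 2 - 2%:R * G k) by rewrite -cE; lra.
  rewrite /G -/s.
  have : 0 <= (1 - s) ^+ 4 by rewrite exprn_even_ge0.
  lra.
set S := a + b - dmax a b + 2%:R * (posp (s - a) * posp (s - b)).
have S0 : 0 <= S by rewrite /S; have := S_ge0 kN; have := mulr_ge0 (posp_ge0 (s - a)) (posp_ge0 (s - b)); rewrite /= -/a -/b; lra.
have pt : 1 + cc s - cc s ^+ 2 / 2%:R - E <= S + cc s * (2%:R - a - b).
  rewrite /S /dmax mulrA; case: (leP a b) => ab.
    by apply: le_trans (free_point (cc_half s0 s1) (cc_lin s0 s1) c3 sh s1 E0 hE a0 ab b1) _; lra.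
  by apply: le_trans (free_point (cc_half s0 s1) (cc_lin s0 s1) c3 sh s1 E0 hE b0 (ltW ab) a1) _; lra.
apply: (term_ge kN S0 (succ_sym kN) (outerD kN)); rewrite -/a -/b -/s.
have := ler_wpM2l (ltW s2) pt.
have -> : 2%:R * s ^+ 2 * (1 + cc s - cc s ^+ 2 / 2%:R - E) =
  2%:R * s ^+ 2 + G k - 2%:R * s ^+ 2 * cc s ^+ 2 / 2%:R - (1 - s) ^+ 2 * (2%:R * s - 1) ^+ 2.
  by rewrite -cE /E; field; rewrite gt_eqF.
have -> : 2%:R * s ^+ 2 * (S + cc s * (2%:R - a - b)) = 2%:R * s ^+ 2 * S + G k * (2%:R - a - b).
  by rewrite -cE; ring.
suff : 2%:R * s ^+ 2 * cc s ^+ 2 / 2%:R <=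
   (219%:R/16%:R - 845%:R/32%:R * s + 225%:R/16%:R * s ^+ 2) / 36%:R + s / 9%:R + s ^+ 4 / 9%:R.
  by rewrite /freepoly /G -/s; lra.
have -> : 2%:R * s ^+ 2 * cc s ^+ 2 / 2%:R = (1 + 2%:R * s ^+ 3) ^+ 2 / (36%:R * s ^+ 2).
  by rewrite /cc; field; rewrite gt_eqF.
rewrite ler_pdivrMr; last by have := exprn_gt0 2 s0; lra.
(* The quadratic majorant of [1 / s ^+ 2] interpolates it at 1/2 and touches it at 4/5; this product
   is the difference multiplied by [s ^+ 2]. *)
have : 0 <= (s - 4%:R/5%:R) ^+ 2 * (s - 1/2%:R) * (225%:R/16%:R * s + 25%:R/8%:R).
  by apply: mulr_ge0; [apply: mulr_ge0; [exact: sqr_ge0|]|]; lra.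
lra.
Qed.

Let sumw a b : (a <= b <= N)%N -> \sum_(a <= k < b) 5%:R/2%:R * h * w k <= 5%:R/3%:R * h.
Proof.
move=> /andP[ab bN]; rewrite -mulr_sumr telescope_sumr //.
have b1 : fr b ^+ 3 <= 1 by rewrite exprn_ile1 ?fr1.
have a0 : 0 <= fr a ^+ 3 by rewrite exprn_ge0.
have : G b - G a <= 2%:R/3%:R by rewrite /G; lra.
move/(ler_wpM2l (ltW h0)); lra.
Qed.

Lemma inner_sum m : (m <= P N)%N -> (m <= n)%N ->
  2%:R/3%:R * fr m + fr m ^+ 4 / 3%:R + 2%:R/3%:R * fr m ^+ 5 - fr m ^+ 2 / 6%:R - 12%:R * h
  <= \sum_(0 <= k < m) levelterm k.
Proof.
move=> mP mn; have mN : (0 <= m <= N)%N by rewrite (leq_trans mP).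
have T1 : fr m <= 1 by apply/fr1; case/andP: mN.
have p0 := power_sum R 0 N0 mN; have p3 := power_sum R 3 N0 mN; have p4 := power_sum R 4 N0 mN.
have f00 : fr 0 = 0 by rewrite /frac mul0r.
rewrite f00 !expr0n /= in p0 p3 p4.
have pd : (\sum_(0 <= k < m) (dA k + dB k))%:R * h ^+ 2 / 3%:R <= fr m ^+ 2 / 6%:R + 5%:R/6%:R * h.
  set D := (\sum_(0 <= k < m) _)%N.
  have sqR : 2%:R * D%:R <= m%:R * (m%:R + 1) + 4%:R * NR.
    rewrite natr1 -!natrM -natrD ler_nat; apply: leq_trans (sq mP).
    by rewrite /D big_mkord leq_mul2l /=; apply: leq_sum => k _; rewrite addnC.
  have hh : 0 <= h ^+ 2 by rewrite exprn_ge0 // ltW.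
  move: sqR => /(ler_wpM2r hh); rewrite (frE m).
  have -> : (NR * fr m * (NR * fr m + 1) + 4%:R * NR) * h ^+ 2 =
     (NR * h) ^+ 2 * fr m ^+ 2 + (NR * h) * h * fr m + 4%:R * (NR * h) * h by ring.
  rewrite Nh; have := ler_wpM2l (ltW h0) T1; lra.
have p2 : \sum_(0 <= k < m) 2%:R * h ^+ 2 <= 2%:R * h :> R.
  rewrite big_mkord sumr_const card_ord -[_ *+ m]mulr_natr.
  have -> : 2%:R * h ^+ 2 * m%:R = 2%:R * h * fr m by rewrite /frac; ring.
  have := ler_wpM2l (ltW h0) T1; lra.
have pw := sumw mN.
have : \sum_(0 <= k < m) (2%:R/3%:R * (h * fr k ^+ 0) + 4%:R/3%:R * (h * fr k ^+ 3)
   + 10%:R/3%:R * (h * fr k ^+ 4) - 5%:R/2%:R * h * w k - (dA k + dB k)%:R * (h ^+ 2 / 3%:R) - 2%:R * h ^+ 2) <=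
  \sum_(0 <= k < m) levelterm k.
  rewrite !big_mkord; apply: ler_sum => k _.
  apply: le_trans (inner_term (leq_trans (ltn_ord k) mP) (leq_trans (ltn_ord k) mn)).
  by rewrite /G; lra.
apply: le_trans; move: p0 p3 p4 pd p2 pw.
rewrite [X in _ -> _ -> _ -> _ -> _ -> _ -> _ <= X](_ : _ =
  2%:R/3%:R * (\sum_(0 <= k < m) h * fr k ^+ 0) + 4%:R/3%:R * (\sum_(0 <= k < m) h * fr k ^+ 3)
   + 10%:R/3%:R * (\sum_(0 <= k < m) h * fr k ^+ 4) - (\sum_(0 <= k < m) 5%:R/2%:R * h * w k)
   - (\sum_(0 <= k < m) (dA k + dB k))%:R * (h ^+ 2 / 3%:R) - (\sum_(0 <= k < m) 2%:R * h ^+ 2)); last first.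
  by rewrite natr_sum mulr_suml !mulr_sumr -!big_split -!sumrB.
lra.
Qed.

(** If [P N <= n], the inner bound is used up to [P N] and the outer one beyond it. Otherwise the
    inner bound is used up to 1/2 and [free_term], which needs nothing about [P N], from there
    on. *)
Lemma level_sum : 1141%:R/1000%:R - 40%:R * h <= \sum_(k < N) levelterm k.
Proof.
rewrite -(big_mkord xpredT levelterm).
have [PTn|PTn] := leqP (P N) n.
  set T := fr (P N); have T0 : 0 <= T := fr0 _.
  have T1 : T <= 1/2%:R by rewrite -frhalf; apply: frle.
  have bN : (P N <= N <= N)%N by rewrite P_le leqnn.
  rewrite (big_cat_nat (n := P N)) //=.
  have i1 := inner_sum (leqnn (P N)) PTn; rewrite -/T in i1.
  have p0 := power_sum R 0 N0 bN; have p2 := power_sum R 2 N0 bN; have p3 := power_sum R 3 N0 bN.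
  rewrite frN !expr1n -/T in p0 p2 p3; have pw := sumw bN.
  have : \sum_(P N <= k < N) (2%:R * (1 + T ^+ 2 / 2%:R) * (h * fr k ^+ 2) + (1 - T) / 3%:R * (h * fr k ^+ 0)
    + 2%:R/3%:R * (1 - T) * (h * fr k ^+ 3) - 5%:R/2%:R * h * w k) <= \sum_(P N <= k < N) levelterm k.
    rewrite big_nat_cond [X in _ <= X]big_nat_cond; apply: ler_sum => k /andP[/andP[k1 k2] _].
    by apply: le_trans (outer_term k2 k1 PTn); rewrite /G -/T; lra.
  rewrite [X in X <= _](_ : _ = 2%:R * (1 + T ^+ 2 / 2%:R) * (\sum_(P N <= k < N) h * fr k ^+ 2)
    + (1 - T) / 3%:R * (\sum_(P N <= k < N) h * fr k ^+ 0)
    + 2%:R/3%:R * (1 - T) * (\sum_(P N <= k < N) h * fr k ^+ 3)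
    - (\sum_(P N <= k < N) 5%:R/2%:R * h * w k)); last by rewrite !mulr_sumr -!big_split -!sumrB.
  move=> o1.
  case/andP: p0 => p0 _; case/andP: p2 => p2 _; case/andP: p3 => p3 _.
  have c1 : 0 <= 2%:R * (1 + T ^+ 2 / 2%:R) by have := sqr_ge0 T; lra.
  have c2 : 0 <= (1 - T) / 3%:R by lra.
  have c3 : 0 <= 2%:R/3%:R * (1 - T) by lra.
  have q1 := ler_wpM2l c1 p2; have q2 := ler_wpM2l c2 p0; have q3 := ler_wpM2l c3 p3.
  have hb : T ^+ 2 * h <= h by rewrite ger_pMl // exprn_ile1 //; lra.
  have hT : 0 <= T * h by apply: mulr_ge0 => //; exact: ltW.
  (* The right side is three times the limit of the total as a function of [T]. *)
  have fin : 3423%:R/1000%:R <= 35%:R/10%:R - T / 2%:R + 3%:R/2%:R * T ^+ 2 - 2%:R * T ^+ 3 + T ^+ 4 / 2%:R + 3%:R/2%:R * T ^+ 5.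
    have a1 := sqr_ge0 (T - 1/4%:R).
    have a2 := sqr_ge0 (T ^+ 2 - 4%:R/25%:R).
    have a3 : 0 <= T * (T ^+ 2 - 4%:R/25%:R) ^+ 2 by apply: mulr_ge0 => //; exact: sqr_ge0.
    have a4 : 0 <= (1/2%:R - T) * (T - 1/4%:R) ^+ 2 by apply: mulr_ge0; [lra|exact: sqr_ge0].
    lra.
  have hh := ltW h0; lra.
have nN : (n <= N <= N)%N by rewrite leqnn andbT /N -addnn leq_addr.
rewrite (big_cat_nat (n := n)) //=; last by case/andP: nN.
have := inner_sum (ltnW PTn) (leqnn n); rewrite frhalf => i1.
have p0 := power_sum R 0 N0 nN; have p1 := power_sum R 1 N0 nN.
have p2 := power_sum R 2 N0 nN; have p3 := power_sum R 3 N0 nN; have p4 := power_sum R 4 N0 nN.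
rewrite frN frhalf !expr1n in p0 p1 p2 p3 p4; have pw := sumw nN.
have : \sum_(n <= k < N) ((1/3%:R - 219%:R/576%:R - 1) * (h * fr k ^+ 0)
  + (845%:R/1152%:R - 1/9%:R + 6%:R) * (h * fr k ^+ 1)
  + (2%:R - 225%:R/576%:R - 13%:R) * (h * fr k ^+ 2) + (2%:R/3%:R + 12%:R) * (h * fr k ^+ 3)
  + (- 1/9%:R - 4%:R) * (h * fr k ^+ 4) - 5%:R/2%:R * h * w k) <= \sum_(n <= k < N) levelterm k.
  rewrite big_nat_cond [X in _ <= X]big_nat_cond; apply: ler_sum => k /andP[/andP[k1 k2] _].
  by apply: le_trans (free_term k2 k1); rewrite /freepoly; lra.
rewrite [X in X <= _](_ : _ = (1/3%:R - 219%:R/576%:R - 1) * (\sum_(n <= k < N) h * fr k ^+ 0)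
  + (845%:R/1152%:R - 1/9%:R + 6%:R) * (\sum_(n <= k < N) h * fr k ^+ 1)
  + (2%:R - 225%:R/576%:R - 13%:R) * (\sum_(n <= k < N) h * fr k ^+ 2)
  + (2%:R/3%:R + 12%:R) * (\sum_(n <= k < N) h * fr k ^+ 3)
  + (- 1/9%:R - 4%:R) * (\sum_(n <= k < N) h * fr k ^+ 4)
  - (\sum_(n <= k < N) 5%:R/2%:R * h * w k)); last by rewrite !mulr_sumr -!big_split -!sumrB.
have hh := ltW h0; lra.
Qed.

End RealAssembly.

(** * Gains *)

Section Smatch.
Variable V : finType.

(** The default [id] does not occur for the graphs and ranks at hand, by [stable_exists]. *)
Definition smatch (e : rel V) (N : nat) (r : V -> nat) : V -> V :=
  if pselect (exists f, stable e (crank r) (N * vcard V) f) is left ex then projT1 (cid ex) else id.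

Lemma smatchP e N r : symmetric e -> irreflexive e -> (forall v, (r v < N)%N) ->
  stable e (crank r) (N * vcard V) (smatch e N r).
Proof.
move=> es ei rN; rewrite /smatch; case: pselect => [ex|[]]; first exact: (projT2 (cid ex)).
exact: stable_exists.
Qed.

End Smatch.

Section Gain.
Variables (R : realFieldType) (V : finType) (N : nat) (G : nat -> R).
Hypothesis GN : G N = 1.
Local Notation K := (vcard V).

Definition gain (r : V -> nat) (f : V -> V) v : R :=
  if f v == v then 0 else 1 + G (r v) - G (r (f v)).

(** The two [G] terms of a vertex cancel against those of its mate. *)
Lemma sum_gain r f : involutive f -> \sum_v gain r f v = #|[set v | f v != v]|%:R.
Proof.
move=> fi.
have E : \sum_v (if f v == v then 0 else G (r v)) = \sum_v (if f v == v then 0 else G (r (f v))).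
  by rewrite [RHS](reindex_inj (inv_inj fi)); apply: eq_bigr => v _; rewrite fi eq_sym.
transitivity (\sum_v ((f v != v)%:R + ((if f v == v then 0 else G (r v)) - (if f v == v then 0 else G (r (f v)))))).
  by apply: eq_bigr => v _; rewrite /gain; case: eqP => _ /=; ring.
rewrite big_split /= sumrB E subrr addr0 -sum1_card natr_sum [RHS]big_mkcond /=.
by apply: eq_bigr => v _; rewrite inE; case: (f v == v).
Qed.

Lemma prk_level (r : V -> nat) f v t : (forall v, (r v < N)%N) -> (t <= N)%N ->
  (partner_rank (crank r) (N * K) f v < t * K)%N = (f v != v) && (r (f v) < t)%N.
Proof.
move=> rN tN; rewrite /partner_rank; case: eqP => _ /=; last by rewrite crank_lt.
by apply/negbTE; rewrite -leqNgt leq_mul2r tN orbT.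
Qed.

Lemma step_sum m : (m <= N)%N -> \sum_(k < N) (G k.+1 - G k) * (m < k.+1)%N%:R = 1 - G m.
Proof.
move=> mN; rewrite -(big_mkord xpredT (fun k => (G k.+1 - G k) * (m < k.+1)%N%:R)) (big_cat_nat (n := m)) //=.
rewrite big_nat_cond big1 ?add0r; last by move=> k /andP[/andP[_ km] _]; rewrite ltnS leqNgt km mulr0.
rewrite big_nat_cond (eq_bigr (fun k => G k.+1 - G k)); last by move=> k /andP[/andP[mk _] _]; rewrite ltnS mk mulr1.
by rewrite -big_nat_cond telescope_sumr // GN.
Qed.

(** As [G N = 1], the difference [1 - G (r (f v))] telescopes into the increments of [G] over the
    levels that the partner's rank lies below. *)
Lemma gain_levels r f v : (forall v, (r v < N)%N) ->
  gain r f v = \sum_(k < N) (G k.+1 - G k) * (partner_rank (crank r) (N * K) f v < k.+1 * K)%N%:R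
     + G (r v) * (partner_rank (crank r) (N * K) f v < N * K)%N%:R.
Proof.
move=> rN; rewrite (eq_bigr (fun k : 'I_N => (G k.+1 - G k) * ((f v != v) && (r (f v) < k.+1)%N)%:R));
  last by move=> k _; rewrite prk_level.
rewrite prk_level // rN andbT /gain; case: eqP => _ /=.
  by rewrite big1 ?add0r ?mulr0 // => k _; rewrite mulr0.
by rewrite step_sum ?(ltnW (rN _)) // mulr1; ring.
Qed.

End Gain.

(** * The average gain of an edge *)

Lemma reset2C (V : finType) (r : V -> nat) u w x y : u != w ->
  reset2 r w u y x = reset2 r u w x y.
Proof.
move=> uw; apply: funext => v; rewrite /reset2; case: (v =P u) => [->|//].
by rewrite (negbTE uw).
Qed.

Lemma low_nbrC (V : finType) (e : rel V) u w r t v : low_nbr e w u r t v = low_nbr e u w r t v.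
Proof. by apply/setP => p; rewrite !inE; congr (_ && _); rewrite andbCA. Qed.

Lemma low_nbr_mono (V : finType) (e : rel V) u w r v t t' : (t <= t')%N ->
  low_nbr e u w r t v \subset low_nbr e u w r t' v.
Proof.
move=> tt; apply/subsetP => p; rewrite !inE => /and4P[-> -> -> h] /=; exact: leq_trans h tt.
Qed.

Section SideSums.
Variables (R : realFieldType) (N : nat).

Lemma sum_negb n (b : nat -> bool) :
  \sum_(y < n) (b y)%:R = n%:R - (\sum_(y < n) ~~ b y)%N%:R :> R.
Proof.
rewrite natr_sum; apply/eqP; rewrite eq_sym subr_eq -big_split /= (eq_bigr (fun=> 1)).
  by rewrite sumr_const card_ord.
by move=> y _; case: (b y); rewrite /= ?addr0 ?add0r.
Qed.

Lemma sum_side (G : nat -> R) (A : nat -> nat -> nat -> bool) (g : nat -> nat -> R) :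
  (forall x y, (x < N)%N -> (y < N)%N ->
     g x y = \sum_(k < N) (G k.+1 - G k) * (A x y k.+1)%:R + G x * (A x y N)%:R) ->
  \sum_(x < N) \sum_(y < N) g x y =
  \sum_(k < N) ((G k.+1 - G k) * (N%:R ^+ 2 - (failA N A k.+1)%:R)
     + G k * (N%:R - (rowA N A k N)%:R)).
Proof.
move=> H; rewrite [RHS]big_split /=.
have -> : \sum_(x < N) \sum_(y < N) g x y =
  \sum_(x < N) (\sum_(k < N) \sum_(y < N) (G k.+1 - G k) * (A x y k.+1)%:R + G x * (N%:R - (rowA N A x N)%:R)).
  apply: eq_bigr => x _.
  rewrite (eq_bigr (fun y : 'I_N => \sum_(k < N) (G k.+1 - G k) * (A x y k.+1)%:R + G x * (A x y N)%:R)); last by move=> y _; apply: H.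
  rewrite big_split /= exchange_big /=; congr (_ + _).
  by rewrite -mulr_sumr (sum_negb N (fun y => A x y N)).
rewrite big_split /=; congr (_ + _); rewrite exchange_big /=; apply: eq_bigr => k _.
transitivity (\sum_(x < N) (G k.+1 - G k) * (N%:R - (rowA N A x k.+1)%:R)).
  by apply: eq_bigr => x _; rewrite -mulr_sumr (sum_negb N (fun y => A x y k.+1)).
rewrite -mulr_sumr; congr (_ * _).
by rewrite sumrB sumr_const card_ord -[_ *+ N]mulr_natr -expr2 /failA natr_sum.
Qed.

End SideSums.

Section Pair.
Variables (R : realFieldType) (V : finType) (e : rel V) (n : nat).
Hypotheses (n0 : (0 < n)%N) (e_sym : symmetric e) (e_irr : irreflexive e).
Local Notation N := n.*2.
Local Notation K := (vcard V).
Local Notation G := (cubicG R n).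
Local Notation prk r f := (partner_rank (crank r) (N * K) f).

Lemma cubicG_top : G N = 1.
Proof.
rewrite /cubicG /frac divff ?expr1n; last by rewrite pnatr_eq0 double_eq0 -lt0n.
by field.
Qed.

Definition pgain r v : R := gain G r (smatch e N r) v.

(** [level_sum] treats the two ends asymmetrically, so the end with the smaller acceptance set comes
    first; [pair_gain] removes this by exchanging the ends. *)
Lemma pair_oriented u w (r : V -> nat) fH : e u w -> (forall v, (r v < N)%N) ->
  stable (del u (del w e)) (crank r) (N * K) fH ->
  (forall q, e u q -> e q w -> False) ->
  (capP (fun t => low_nbr e u w r t u) (fun p => thr u (prk r fH p)) N <=
   capQ (fun t => low_nbr e u w r t w) (fun p => thr w (prk r fH p)) N)%N ->
  N%:R ^+ 2 * (1141%:R/1000%:R - 40%:R * N%:R^-1) <=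
  \sum_(x < N) \sum_(y < N) (pgain (reset2 r u w x y) u + pgain (reset2 r u w x y) w).
Proof.
move=> euw rN sH tri cap.
have uw : u != w by apply/eqP => E; move: euw; rewrite E e_irr.
have wu : w != u by rewrite eq_sym.
have ewu : e w u by rewrite e_sym.
pose rr x y := reset2 r u w x y.
pose A x y t := (prk (rr x y) (smatch e N (rr x y)) u < t * K)%N.
pose B x y t := (prk (rr x y) (smatch e N (rr x y)) w < t * K)%N.
have rrN x y (xN : (x < N)%N) (yN : (y < N)%N) v : (rr x y v < N)%N.
  by rewrite /rr /reset2; case: ifP => // _; case: ifP.
have sf x y (xN : (x < N)%N) (yN : (y < N)%N) : stable e (crank (rr x y)) (N * K) (smatch e N (rr x y)).
  by apply: smatchP => //; apply: rrN.
have sf' x y (xN : (x < N)%N) (yN : (y < N)%N) : stable e (crank (reset2 r w u y x)) (N * K) (smatch e N (rr x y)).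
  by rewrite (reset2C r x y uw); apply: sf.
have sH' : stable (del w (del u e)) (crank r) (N * K) fH by apply: stable_ext sH; apply: del_comm.
pose IP t := low_nbr e u w r t u; pose IQ t := low_nbr e u w r t w.
pose sP p := thr u (prk r fH p); pose sQ p := thr w (prk r fH p).
have tri' q : e w q -> e q u -> False by move=> a b; apply: (tri q); rewrite e_sym.
have HB1 x y t : (x < N)%N -> (y < N)%N -> (t <= N)%N -> ~~ B x y t ->
  forall q, q \in IQ t -> (y < sQ q)%N ->
  (exists2 p, p \in IP t & (x < sP p <= y.+1)%N) /\ (forall q', q' \in IQ t -> (y < sQ q')%N -> q' = q).
  move=> xN yN tN; rewrite -leqNgt => nB q qI qs.
  exact: (hurt_level e_sym e_irr uw rN sH xN yN (sf x y xN yN) tri nB qI qs).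
have HA1 x y t : (x < N)%N -> (y < N)%N -> (t <= N)%N -> ~~ A x y t ->
  forall p, p \in IP t -> (x < sP p)%N ->
  (exists2 q, q \in IQ t & (y < sQ q <= x.+1)%N) /\ (forall p', p' \in IP t -> (x < sP p')%N -> p' = p).
  move=> xN yN tN; rewrite -leqNgt => nA q qI qs.
  have := @hurt_level V e N e_sym e_irr w u r fH wu rN sH' y x _ yN xN (sf' x y xN yN) tri' t q.
  by rewrite (reset2C r x y uw) !(low_nbrC e u w); apply.
have HA2 x y t : (x < N)%N -> (y < N)%N -> (t <= N)%N -> ~~ A x y t -> (y < t)%N ->
  exists2 q, q \in IQ x.+1 & (y < sQ q)%N.
  move=> xN yN tN; rewrite -leqNgt => nA yt.
  exact: (fail_level e_sym e_irr uw euw rN sH xN yN (sf x y xN yN) nA yt).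
have HB2 x y t : (x < N)%N -> (y < N)%N -> (t <= N)%N -> ~~ B x y t -> (x < t)%N ->
  exists2 p, p \in IP y.+1 & (x < sP p)%N.
  move=> xN yN tN; rewrite -leqNgt => nB xt.
  have := @fail_level V e N e_sym e_irr w u r fH wu ewu rN sH' y x _ yN xN (sf' x y xN yN) t.
  by rewrite (reset2C r x y uw) !(low_nbrC e u w); apply.
have cN v : (crank r v < N * K)%N by rewrite crank_lt.
have sP_le p : (sP p <= N)%N by apply/thr_leN/prk_le.
have sQ_le p : (sQ p <= N)%N by apply/thr_leN/prk_le.
have IPm t t' : (t <= t')%N -> IP t \subset IP t' by apply: low_nbr_mono.
have IQm t t' : (t <= t')%N -> IQ t \subset IQ t' by apply: low_nbr_mono.
have LS := @level_sum R n n0 (fun t => failA N A t + failB N B t)%N (capP IP sP) (capQ IQ sQ)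
  (fun k => rowA N A k N) (fun k => colB N B k N) (capP_le IP sP_le) (capQ_le IQ sQ_le)
  (fun t => @capP_mono V IP sP IPm t N)
  (fun t => @level_sym V N IP IQ sP sQ A B IPm IQm sP_le sQ_le HA1 HB1 HA2 HB2 t)
  (fun t => @level_T V N IP IQ sP sQ A B IPm IQm sP_le sQ_le HA1 HB1 HA2 HB2 t)
  (fun k => @rowA_cap V N IQ sQ A HA2 k) (fun k => @colB_cap V N IP sP B HB2 k)
  (fun k => @rowA_diag V N IP IQ sP sQ A sP_le HA1 k)
  (fun k kP => @colB_diag V N IP IQ sP sQ B sQ_le HB1 k (leq_trans kP cap))
  (fun m => @square_sum V N IP IQ sP sQ A B sP_le sQ_le HA1 HB1 m cap).
have NR0 : N%:R != 0 :> R by rewrite pnatr_eq0 double_eq0 -lt0n.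
have N2 : 0 < N%:R ^+ 2 :> R by rewrite exprn_gt0 // ltr0n double_gt0.
have S1 := @sum_side R N G A (fun x y => pgain (rr x y) u).
have S2 := @sum_side R N G (fun y x t => B x y t) (fun y x => pgain (rr x y) w).
rewrite (eq_bigr (fun x : 'I_N => \sum_(y < N) pgain (rr x y) u + \sum_(y < N) pgain (rr x y) w)); last first.
  by move=> x _; rewrite big_split.
rewrite big_split /= [X in _ <= _ + X]exchange_big /= S1; last first.
  move=> x y xN yN; rewrite /pgain (gain_levels cubicG_top); last exact: rrN.
  by rewrite /rr {3}/reset2 eqxx.
rewrite S2; last first.
  move=> y x yN xN; rewrite /pgain (gain_levels cubicG_top); last exact: rrN.
  by rewrite /rr {3}/reset2 (negbTE wu) eqxx.
rewrite -big_split /=; move: LS; rewrite -(ler_pM2l N2) mulr_sumr => LS; apply: le_trans LS _.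
apply: ler_sum => k _; rewrite /levelterm /cubicW !natrD le_eqVlt; apply/orP; left; apply/eqP.
rewrite -[failB N B k.+1]/(failA N (fun y x t => B x y t) k.+1).
rewrite -[colB N B k N]/(rowA N (fun y x t => B x y t) k N).
by field.
Qed.

Lemma pair_gain u w (r : V -> nat) : e u w -> (forall v, (r v < N)%N) ->
  (forall q, e u q -> e q w -> False) ->
  N%:R ^+ 2 * (1141%:R/1000%:R - 40%:R * N%:R^-1) <=
  \sum_(x < N) \sum_(y < N) (pgain (reset2 r u w x y) u + pgain (reset2 r u w x y) w).
Proof.
move=> euw rN tri.
have uw : u != w by apply/eqP => E; move: euw; rewrite E e_irr.
have [fH sH] : exists f, stable (del u (del w e)) (crank r) (N * K) f.
  apply: stable_exists rN; first by do 2!apply: del_sym.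
  by move=> v; rewrite /del e_irr.
case: (leqP (capP (fun t => low_nbr e u w r t u) (fun p => thr u (prk r fH p)) N)
  (capQ (fun t => low_nbr e u w r t w) (fun p => thr w (prk r fH p)) N)) => cap.
  exact: (pair_oriented euw rN sH tri cap).
have sH' : stable (del w (del u e)) (crank r) (N * K) fH by apply: stable_ext sH; apply: del_comm.
have ewu : e w u by rewrite e_sym.
have tri' q : e w q -> e q u -> False by move=> a b; apply: (tri q); rewrite e_sym.
have := @pair_oriented w u r fH ewu rN sH' tri' _.
rewrite exchange_big /= /capP /capQ !(low_nbrC e u w) => H.
apply: le_trans (H (ltnW cap)) _; apply: ler_sum => y _; apply: ler_sum => x _.
by rewrite (reset2C r y x uw) addrC.
Qed.

End Pair.

(** * Maximum matchings and averages over rank vectors *)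

Lemma edge_setP (V : finType) (e : rel V) (s : {set V}) :
  reflect (exists a b, e a b /\ s = [set a; b]%SET) (s \in edge_set e).
Proof.
apply: (iffP imsetP) => [[[a b]]|[a [b [ab ->]]]].
  by rewrite inE /= => ab ->; exists a, b.
by exists (a, b); rewrite ?inE.
Qed.

(** Turns a maximum set of disjoint edges into a partner involution, the form in which all later
    sums run over matched vertices. *)
Lemma max_matching_partner (V : finType) (e : rel V) : symmetric e -> irreflexive e ->
  exists o : V -> V, [/\ involutive o, forall z, o z != z -> e z (o z) &
    #|[set z | o z != z]%SET| = (2 * matching_number e)%N].
Proof.
move=> es ei.
have [M mM EM] : exists2 M : {set {set V}}, matching e M & #|M| = matching_number e.
  have ne : (0 < #|matching e|)%N.
    apply/card_gt0P; exists finset.set0; rewrite unfold_in /matching finset.sub0set /=.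
    by apply/finset.trivIsetP => A B; rewrite finset.in_set0.
  by have [M mM EM] := eq_bigmax_cond (fun M : {set {set V}} => #|M|) ne; exists M.
have /andP[sub tI] := mM.
pose o z := if [pick w | (w != z) && ([set z; w]%SET \in M)] is Some w then w else z.
have oP z : (o z != z) -> [set z; o z]%SET \in M.
  by rewrite /o; case: pickP => [w /andP[_ h]|_]; rewrite ?eqxx.
have oin z w : w != z -> [set z; w]%SET \in M -> o z != z.
  move=> wz wM; rewrite /o; case: pickP => [w' /andP[h _] //|/(_ w)]; by rewrite wz wM.
have edge z w : w != z -> [set z; w]%SET \in M -> e z w.
  move=> wz /(fintype.subsetP sub) /edge_setP[a [b [ab E]]].
  have : z \in [set a; b]%SET by rewrite -E !inE eqxx.
  have : w \in [set a; b]%SET by rewrite -E !inE eqxx orbT.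
  rewrite !inE => /orP[]/eqP wE /orP[]/eqP zE; move: wz; rewrite wE zE ?eqxx //.
  by rewrite es.
have share z A B : A \in M -> B \in M -> z \in A -> z \in B -> A = B.
  move=> AM BM zA zB; apply/eqP; apply: contraT => AB.
  have := finset.trivIsetP tI A B AM BM AB.
  by rewrite -finset.setI_eq0 => /eqP/finset.setP/(_ z); rewrite !inE zA zB.
have oo z : o (o z) = z.
  have [E|h] := eqVneq (o z) z; first by rewrite !E.
  have zM := oP _ h.
  have wM : [set o z; z]%SET \in M by rewrite finset.setUC.
  have zw : z != o z by rewrite eq_sym.
  have h2 := oin _ _ zw wM.
  have E := share (o z) _ _ (oP _ h2) wM.
  have : o (o z) \in [set o z; z]%SET by rewrite -E ?inE ?eqxx ?orbT.
  by rewrite !inE (negbTE h2) => /eqP.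
exists o; split=> // [z h|]; first by apply: edge (oP _ h).
rewrite -EM; have -> : [set z | o z != z]%SET = finset.cover M.
  apply/finset.setP => z; rewrite inE; apply/idP/finset.bigcupP => [h|[s sM zs]].
    by exists [set z; o z]%SET; rewrite ?oP // !inE eqxx.
  have /edge_setP[a [b [ab E]]] := fintype.subsetP sub _ sM.
  have abn : a != b by apply/eqP => E1; move: ab; rewrite E1 ei.
  move: zs sM; rewrite E !inE => /orP[]/eqP -> sM; first by apply: (oin _ b); rewrite 1?eq_sym.
  by apply: (oin _ a) => //; rewrite finset.setUC.
have /eqP <- := tI.
rewrite (eq_bigr (fun=> 2%N)); first by rewrite sum_nat_const mulnC.
move=> s sM; have /edge_setP[a [b [ab ->]]] := fintype.subsetP sub _ sM.
by rewrite finset.cards2; case: eqP => // E1; move: ab; rewrite E1 ei.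
Qed.

Section Average.
Variables (R : realFieldType) (V : finType) (N : nat).

Definition upd (r : {ffun V -> 'I_N}) u (x : 'I_N) : {ffun V -> 'I_N} :=
  [ffun v => if v == u then x else r v].
Definition nrank (r : {ffun V -> 'I_N}) : V -> nat := fun v => r v.

Lemma nrank_lt r v : (nrank r v < N)%N. Proof. exact: ltn_ord. Qed.

(** Resampling the rank of [u]: exchanging the fresh value with the old one is an involution on
    pairs. *)
Lemma avg_upd u (F : {ffun V -> 'I_N} -> R) :
  \sum_r \sum_(x < N) F (upd r u x) = N%:R * \sum_r F r.
Proof.
rewrite (pair_big xpredT xpredT (fun r x => F (upd r u x))) /=.
pose h (p : {ffun V -> 'I_N} * 'I_N) := (upd p.1 u p.2, p.1 u).
have hK : involutive h.
  move=> [r x]; rewrite /h /=; congr (_, _); last by rewrite ffunE eqxx.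
  by apply/ffunP => v; rewrite !ffunE; case: eqP => [->|].
rewrite (reindex_inj (inv_inj hK)) /=.
rewrite (eq_bigr (fun p => F p.1)); last first.
  move=> [r x] _ /=; congr F; apply/ffunP => v; rewrite !ffunE; case: eqP => [->|] //.
rewrite -(pair_big xpredT xpredT (fun r x => F r)) /= mulr_sumr.
by apply: eq_bigr => r _; rewrite sumr_const card_ord mulr_natl.
Qed.

(** Union bound over ordered pairs of distinct vertices, each of which collides for a share [1 / N]
    of the rank vectors. *)
Lemma noninj_count :
  N%:R * (\sum_(r : {ffun V -> 'I_N}) (~~ injectiveb r)%:R) <= #|V|%:R ^+ 2 * (N%:R ^+ #|V|) :> R.
Proof.
have cardF : #|{ffun V -> 'I_N}|%:R = N%:R ^+ #|V| :> R by rewrite card_ffun card_ord natrX.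
apply: (@le_trans _ _ (N%:R * \sum_(r : {ffun V -> 'I_N}) \sum_(p : V * V | p.1 != p.2) (r p.1 == r p.2)%:R)).
  apply: ler_wpM2l => //; apply: ler_sum => r _.
  case: injectiveP => [_|ni] /=; first by rewrite mulr0n; apply: sumr_ge0 => p _; apply: ler0n.
  have [a [b [ab E]]] : exists a b, a != b /\ r a = r b.
    apply: contrapT => H; apply: ni => a b E; apply/eqP; apply: contraT => ab.
    by exfalso; apply: H; exists a, b.
  rewrite (bigD1 (a, b)) //= E eqxx lerDl; apply: sumr_ge0 => p _; apply: ler0n.
rewrite exchange_big /= mulr_sumr.
apply: (@le_trans _ _ (\sum_(p : V * V | p.1 != p.2) N%:R ^+ #|V|)).
  apply: ler_sum => -[a b] /= ab.
  rewrite -(avg_upd a (fun r => (r a == r b)%:R)).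
  rewrite (eq_bigr (fun=> 1)); first by rewrite sumr_const cardF.
  have ba : (b == a) = false by rewrite eq_sym (negbTE ab).
  move=> r _; rewrite (bigD1 (r b)) //= !ffunE eqxx ba eqxx big1 ?addr0 //.
  by move=> x xr; rewrite !ffunE eqxx ba (negbTE xr).
rewrite sumr_const -[X in X <= _]mulr_natl ler_wpM2r ?exprn_ge0 //.
by rewrite -natrX ler_nat -[X in (_ <= X)%N]mulnn -card_prod max_card.
Qed.

End Average.

(** * Bounds over all rank vectors *)

Section DeletedVertex.
Variables (V : finType) (e : rel V) (u : V) (rho rho' : V -> nat) (M : nat) (f : V -> V).
Hypothesis sf : stable (del u e) rho M f.
Hypothesis agree : forall v, v != u -> rho v = rho' v.

Lemma prk_del : partner_rank rho M f =1 partner_rank rho' M f.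
Proof.
move=> v; rewrite /partner_rank; case: ifPn => // m; apply: agree.
by have /and3P[] := stable_edge sf m.
Qed.

(** The vertex [u] is isolated in [del u e], so its rank has no influence. *)
Lemma stable_del : stable (del u e) rho' M f.
Proof.
case: (sf) => fi fe fb; split=> // a b ed; rewrite -!prk_del.
by have /and3P[_ au bu] := ed; rewrite -!agree //; apply: fb.
Qed.
End DeletedVertex.

(** * The profile for large odd girth *)

Section QuadProfile.
Variables (R : realFieldType) (N : nat).
Hypothesis N0 : (0 < N)%N.
Local Notation h := (N%:R^-1 : R).
Local Notation fr := (frac R N).

(** A rational substitute for the classical profile [exp (s - 1)], which satisfies [G' = G] and has
    integral [1 - 1/e]; here [G' >= G] and the integral is 83/132. *)
Definition quadG (k : nat) : R := (4%:R + 4%:R * fr k + 2%:R * fr k ^+ 2 + fr k ^+ 3) / 11%:R.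

Let h0 : 0 < h. Proof. by rewrite invr_gt0 ltr0n. Qed.
Let fr0 k : 0 <= fr k. Proof. by rewrite divr_ge0 ?ler0n. Qed.
Let fr1 k : (k <= N)%N -> fr k <= 1.
Proof. by move=> kN; rewrite ler_pdivrMr ?ltr0n // mul1r ler_nat. Qed.

Lemma quadG_top : quadG N = 1.
Proof. by rewrite /quadG /frac divff ?pnatr_eq0 -?lt0n // !expr1n; field. Qed.

Lemma quadG_ge0 k : 0 <= quadG k.
Proof.
rewrite /quadG; have := fr0 k; set s := fr k => s0.
have : 0 <= s ^+ 2 by apply: exprn_ge0.
have : 0 <= s ^+ 3 by apply: exprn_ge0.
lra.
Qed.

Lemma quadG_le1 k : (k <= N)%N -> quadG k <= 1.
Proof.
move=> /fr1; rewrite /quadG; have := fr0 k; set s := fr k => s0 s1.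
have : s ^+ 2 <= 1 by apply: exprn_ile1.
have : s ^+ 3 <= 1 by apply: exprn_ile1.
lra.
Qed.

Lemma quadG_step k : (k <= N)%N -> h * quadG k <= quadG k.+1 - quadG k.
Proof.
move=> /fr1 s1; rewrite /quadG (_ : fr k.+1 = fr k + h); last by rewrite /frac -natr1 mulrDl mul1r.
move: s1 (fr0 k); set s := fr k => s1 s0; have h0' := ltW h0.
have : 0 <= h * (s ^+ 2 * (1 - s)) by do !apply: mulr_ge0 => //; lra.
have : 0 <= h ^+ 2 by apply: exprn_ge0.
have : 0 <= h ^+ 3 by apply: exprn_ge0.
have : 0 <= s * h ^+ 2 by apply: mulr_ge0 => //; apply: exprn_ge0.
lra.
Qed.

Lemma quadG_sum : 83%:R/132%:R - h <= \sum_(x < N) h * quadG x.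
Proof.
rewrite -(big_mkord xpredT (fun x => h * quadG x)).
have NN : (0 <= N <= N)%N by rewrite leqnn.
have p0 := power_sum R 0 N0 NN; have p1 := power_sum R 1 N0 NN.
have p2 := power_sum R 2 N0 NN; have p3 := power_sum R 3 N0 NN.
have f0 : fr 0 = 0 by rewrite /frac mul0r.
have f1 : fr N = 1 by rewrite /frac divff // pnatr_eq0 -lt0n.
rewrite f0 f1 !expr0n !expr1n /= in p0 p1 p2 p3.
rewrite [X in _ <= X](_ : _ = 4%:R/11%:R * (\sum_(0 <= k < N) h * fr k ^+ 0)
  + 4%:R/11%:R * (\sum_(0 <= k < N) h * fr k ^+ 1) + 2%:R/11%:R * (\sum_(0 <= k < N) h * fr k ^+ 2)
  + 1/11%:R * (\sum_(0 <= k < N) h * fr k ^+ 3)); last first.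
  rewrite !mulr_sumr -!big_split; apply: eq_bigr => k _ /=; rewrite /quadG; ring.
lra.
Qed.
End QuadProfile.

(** * The bound for large odd girth *)

Section OddGirth.
Variables (R : realFieldType) (V : finType) (e : rel V) (N : nat).
Hypotheses (N0 : (0 < N)%N) (e_sym : symmetric e) (e_irr : irreflexive e).
Local Notation K := (vcard V).
Local Notation G := (quadG R N).
Local Notation prk r f := (partner_rank (crank r) (N * K) f).
Local Notation sm r := (smatch e N r).
Local Notation smd u r := (smatch (del u e) N r).

Let del_irr u : irreflexive (del u e). Proof. by move=> v; rewrite /del e_irr. Qed.

(** The gain of an edge is regrouped: the level part of one end [z] is paired with the reward
    [G (r u)] of the other end. *)
Definition side (u z : V) (r : V -> nat) : R :=
  \sum_(k < N) (G k.+1 - G k) * (prk r (sm r) z < k.+1 * K)%N%:R + G (r u) * (sm r u != u)%:R.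
Definition hurt_at (u z : V) (r : V -> nat) (t : nat) : bool :=
  (prk r (smd u r) z < t * K <= prk r (sm r) z)%N.

(** The classical argument: up to hurt levels, [z] keeps [1 - G b], and whenever [x < b] the vertex
    [z] would accept [u], so [u] is matched and earns [G x]. As [G' >= G], the quantity
    [N * (1 - G b)] covers the missing [G x] with [x >= b]. *)
Lemma side_avg u z (r : {ffun V -> 'I_N}) : e u z ->
  \sum_(x < N) G x <= \sum_(x < N) (side u z (nrank (upd r u x))
    + \sum_(k < N) (G k.+1 - G k) * (hurt_at u z (nrank (upd r u x)) k.+1)%:R).
Proof.
move=> euz; have zu : z != u by apply/eqP => E; move: euz; rewrite E e_irr.
have sfu := smatchP (del_sym u e_sym) (del_irr u) (nrank_lt r).
set fu := smd u (nrank r) in sfu.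
(* The rank of the mate of [z] in the graph without [u], with [N] for none; it does not depend on
   the rank of [u]. *)
pose b := if fu z == z then N else nrank r (fu z).
have bN : (b <= N)%N by rewrite /b; case: ifP => // _; apply/ltnW/nrank_lt.
have step k : (k < N)%N -> 0 <= G k.+1 - G k.
  by move=> kN; apply: le_trans (quadG_step R N0 (ltnW kN)); rewrite mulr_ge0 ?quadG_ge0 // invr_ge0.
have lvl x k : (k < N)%N -> (prk (nrank (upd r u x)) (smd u (nrank (upd r u x))) z < k.+1 * K)%N = (b < k.+1)%N.
  move=> kN; have ag v : v != u -> crank (nrank r) v = crank (nrank (upd r u x)) v.
    by move=> /negbTE vu; rewrite /crank /nrank ffunE vu.
  have sx := smatchP (del_sym u e_sym) (del_irr u) (nrank_lt (upd r u x)).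
  have ltx v : (crank (nrank (upd r u x)) v < N * K)%N by rewrite crank_lt nrank_lt.
  have E := stable_uniq (@crank_inj _ _) ltx (del_sym u e_sym) sx (stable_del sfu ag).
  rewrite prk_level ?E //; last exact: nrank_lt.
  rewrite /b; case: ifPn => [_|m]; first by rewrite /= ltnS leqNgt kN.
  have /and3P[_ _ fzu] := stable_edge sfu m.
  by rewrite /= /nrank ffunE (negbTE fzu).
have key (x : 'I_N) : (1 - G b) + G x * (x < b)%N%:R <= side u z (nrank (upd r u x))
    + \sum_(k < N) (G k.+1 - G k) * (hurt_at u z (nrank (upd r u x)) k.+1)%:R.
  rewrite -(step_sum (quadG_top R N0) bN) /side addrAC -big_split /=; apply: lerD.
    apply: ler_sum => k _; rewrite -mulrDr; apply: ler_wpM2l; first exact: step.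
    rewrite /hurt_at lvl // -natrD ler_nat; case: (b < k.+1)%N => //=.
    by case: (ltnP (prk (nrank (upd r u x)) (sm (nrank (upd r u x))) z) (k.+1 * K)).
  have -> : nrank (upd r u x) u = x by rewrite /nrank ffunE eqxx.
  apply: ler_wpM2l; first exact: quadG_ge0.
  rewrite ler_nat; case xb: (x < b)%N => //=; rewrite lt0b.
  have ltx v : (crank (nrank (upd r u x)) v < N * K)%N by rewrite crank_lt nrank_lt.
  have sx := smatchP (del_sym u e_sym) (del_irr u) (nrank_lt (upd r u x)).
  have sfx := smatchP e_sym e_irr (nrank_lt (upd r u x)).
  rewrite -(prk_matched ltx).
  apply: leq_ltn_trans (head_best (@crank_inj _ _) ltx sx sfx euz zu _) (ltx z).
  have : (prk (nrank (upd r u x)) (smd u (nrank (upd r u x))) z < x.+1 * K)%N = (b < x.+1)%N by apply: lvl.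
  have -> : (b < x.+1)%N = false by rewrite ltnS leqNgt xb.
  move=> /negbT; rewrite -leqNgt; apply: leq_trans.
  by rewrite crank_lt /nrank ffunE eqxx.
apply: le_trans (ler_sum _ (fun x _ => key x)).
rewrite big_split /= sumr_const card_ord -[_ *+ N]mulr_natl.
have : \sum_(x < N) G x * (b < x.+1)%N%:R <= N%:R * (1 - G b).
  rewrite -(step_sum (quadG_top R N0) bN) mulr_sumr; apply: ler_sum => x _.
  rewrite mulrA; apply: ler_wpM2r => //.
  have /(ler_wpM2l (ler0n R N)) := quadG_step R N0 (ltnW (ltn_ord x)).
  by rewrite [X in X <= _ -> _]mulrA divff ?mul1r // pnatr_eq0 -lt0n.
have -> : \sum_(x < N) G x = \sum_(x < N) G x * (b < x.+1)%N%:R + \sum_(x < N) G x * (x < b)%N%:R.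
  by rewrite -big_split; apply: eq_bigr => x _ /=; rewrite ltnS; case: (leqP b x) => _ /=; rewrite ?mulr1 ?mulr0 ?addr0 ?add0r.
by rewrite lerD2r.
Qed.

Hypothesis girth : forall c : seq V, (2 < size c)%N -> ucycle e c -> odd (size c) -> (129 <= size c)%N.

Definition matched (r : V -> nat) : nat := #|[set v | sm r v != v]%SET|.

(** The factor 7/704 is the total increment 7/11 of the profile times the hurt share 1/64 from
    [hurt_count], applied at each level. *)
Lemma odd_girth_bound mu (o : V -> V) : involutive o -> (forall z, o z != z -> e z (o z)) ->
  #|[set z | o z != z]%SET| = (2 * mu)%N ->
  (2 * mu)%:R * N%:R ^+ #|V| * (83%:R/132%:R - N%:R^-1) <=
  (1 + 7%:R/704%:R) * \sum_(r : {ffun V -> 'I_N}) (matched (nrank r))%:R :> R.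
Proof.
move=> oo oe cardo.
have NR : 0 < N%:R :> R by rewrite ltr0n.
have step k : (k < N)%N -> 0 <= G k.+1 - G k.
  by move=> kN; apply: le_trans (quadG_step R N0 (ltnW kN)); rewrite mulr_ge0 ?quadG_ge0 // invr_ge0.
pose tot z (r : {ffun V -> 'I_N}) : R := side (o z) z (nrank r) + \sum_(k < N) (G k.+1 - G k) * (hurt_at (o z) z (nrank r) k.+1)%:R.
have one z : o z != z -> N%:R ^+ #|V| * (83%:R/132%:R - N%:R^-1) <= \sum_r tot z r.
  move=> oz; have euz : e (o z) z by rewrite e_sym; apply: oe.
  have : \sum_(r : {ffun V -> 'I_N}) \sum_(x < N) G x <= N%:R * \sum_r tot z r.
    rewrite -(avg_upd (o z) (tot z)); apply: ler_sum => r _; exact: side_avg.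
  rewrite sumr_const card_ffun card_ord -[_ *+ _]mulr_natl natrX => H.
  rewrite -(ler_pM2l NR); apply: le_trans H; rewrite mulrCA ler_wpM2l ?exprn_ge0 //.
  have := quadG_sum R N0; rewrite -mulr_sumr => /(ler_wpM2l (ltW NR)).
  by rewrite [X in _ <= X -> _]mulrA divff ?mul1r // gt_eqF.
have all_z : (2 * mu)%:R * (N%:R ^+ #|V| * (83%:R/132%:R - N%:R^-1)) <= \sum_(z | o z != z) \sum_r tot z r.
  rewrite -cardo mulr_natl -sumr_const (eq_bigl (fun z => o z != z)); last by move=> z; rewrite inE.
  by apply: ler_sum => z; apply: one.
rewrite -mulrA; apply: le_trans all_z _; rewrite exchange_big mulr_sumr; apply: ler_sum => r _.
have rN := nrank_lt r; have sf := smatchP e_sym e_irr rN.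
rewrite /tot big_split /= mulrDl mul1r; apply: lerD.
  rewrite /side big_split /=.
  (* Handing the rewards back from [o z] to [z] restores the full gain of every [z]. *)
  rewrite [X in _ + X <= _](reindex_inj (inv_inj oo)) /=.
  rewrite [X in _ + X <= _](_ : _ = \sum_(z | o z != z) G (nrank r z) * (sm (nrank r) z != z)%:R); last first.
    by apply: eq_big => z; [rewrite oo eq_sym | rewrite oo].
  rewrite -big_split /=.
  rewrite /matched -(sum_gain G (nrank r) (stable_inv sf)).
  rewrite [X in _ <= X](bigID (fun z => o z != z)) /=.
  rewrite [X in X <= _](_ : _ = \sum_(z | o z != z) gain G (nrank r) (sm (nrank r)) z).
    rewrite lerDl; apply: sumr_ge0 => v _; rewrite /gain; case: ifP => // _.
    have := quadG_le1 R N0 (ltnW (rN (sm (nrank r) v))); have := quadG_ge0 R N (nrank r v); lra.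
  apply: eq_bigr => z _; rewrite (gain_levels (quadG_top R N0)) //; congr (_ + _ * _%:R).
  by rewrite prk_level // rN andbT.
rewrite exchange_big /=.
have hk (k : 'I_N) : \sum_(z | o z != z) (G k.+1 - G k) * (hurt_at (o z) z (nrank r) k.+1)%:R <=
    (G k.+1 - G k) * ((matched (nrank r))%:R / 64%:R).
  rewrite -mulr_sumr; apply: ler_wpM2l; first exact: step.
  rewrite ler_pdivlMr // mulrC -natr_sum -natrM ler_nat.
  have cN v : (crank (nrank r) v < N * K)%N by rewrite crank_lt.
  have TM : (k.+1 * K <= N * K)%N by rewrite leq_mul2r ltn_ord orbT.
  have := hurt_count e_sym e_irr (@crank_inj _ _) cN sf girth oe
    (fun u => smatchP (del_sym u e_sym) (del_irr u) rN) TM.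
  apply: leq_trans; rewrite leq_mul2l /= -sum1_card [X in (_ <= X)%N]big_mkcond [X in (X <= _)%N]big_mkcond.
  apply: leq_sum => z _; rewrite inE /hurt /hurt_at; case: (o z != z) => //=.
apply: le_trans (ler_sum _ (fun k _ => hk k)) _; rewrite -mulr_suml.
have -> : \sum_(k < N) (G k.+1 - G k) = 7%:R/11%:R.
  have := step_sum (quadG_top R N0) (leq0n N); rewrite (eq_bigr (fun k : 'I_N => G k.+1 - G k)); last by move=> k _; rewrite mulr1.
  by move=> ->; rewrite /quadG /frac mul0r !expr0n /=; field.
by rewrite le_eqVlt; apply/orP; left; apply/eqP; field.
Qed.

End OddGirth.

(** * The bound for triangle-free graphs *)

Section TriangleFree.
Variables (R : realFieldType) (V : finType) (e : rel V) (n : nat).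
Hypotheses (n0 : (0 < n)%N) (e_sym : symmetric e) (e_irr : irreflexive e).
Hypothesis tri : forall u w q, e u w -> e u q -> e q w -> False.
Local Notation N := n.*2.

(** The bound of [pair_gain] is averaged over all rank vectors and summed over the maximum matching,
    where each edge is met twice; the remaining vertices have nonnegative gain. *)
Lemma triangle_free_bound mu (o : V -> V) : involutive o -> (forall z, o z != z -> e z (o z)) ->
  #|[set z | o z != z]%SET| = (2 * mu)%N ->
  mu%:R * N%:R ^+ #|V| * (1141%:R/1000%:R - 40%:R * N%:R^-1) <=
  \sum_(r : {ffun V -> 'I_N}) (matched e N (nrank r))%:R :> R.
Proof.
move=> oo oe cardo.
have NR : 0 < N%:R :> R by rewrite ltr0n double_gt0.
pose F v : R := \sum_(r : {ffun V -> 'I_N}) pgain R e n (nrank r) v.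
have F0 v : 0 <= F v.
  apply: sumr_ge0 => r _; rewrite /pgain /gain; case: ifP => // _.
  have fr0 k : 0 <= frac R N k ^+ 3 by rewrite exprn_ge0 // divr_ge0.
  have fr1 k : (k <= N)%N -> frac R N k ^+ 3 <= 1.
    by move=> kN; rewrite exprn_ile1 // ?divr_ge0 // ler_pdivrMr // mul1r ler_nat.
  have := fr0 (nrank r v); have := fr1 _ (ltnW (nrank_lt r (smatch e N (nrank r) v))).
  rewrite /cubicG; lra.
have pair u w : e u w -> N%:R ^+ #|V| * (1141%:R/1000%:R - 40%:R * N%:R^-1) <= F u + F w.
  move=> euw; have uw : u != w by apply/eqP => E; move: euw; rewrite E e_irr.
  pose g (r : {ffun V -> 'I_N}) : R := pgain R e n (nrank r) u + pgain R e n (nrank r) w.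
  have E : N%:R ^+ 2 * (F u + F w) =
    \sum_(r : {ffun V -> 'I_N}) \sum_(x < N) \sum_(y < N) (pgain R e n (reset2 (nrank r) u w x y) u + pgain R e n (reset2 (nrank r) u w x y) w).
    rewrite /F -big_split /= -/g expr2 -mulrA -(avg_upd u g).
    have /= <- := avg_upd w (fun r => \sum_(x < N) g (upd r u x)).
    apply: eq_bigr => r _; rewrite exchange_big /=; apply: eq_bigr => x _; apply: eq_bigr => y _.
    rewrite /g (_ : nrank (upd (upd r w y) u x) = reset2 (nrank r) u w x y) //.
    by apply: funext => v; rewrite /nrank /reset2 !ffunE; case: ifP => // _; case: ifP.
  rewrite -(ler_pM2l (exprn_gt0 2 NR)) E.
  apply: (@le_trans _ _ (\sum_(r : {ffun V -> 'I_N}) N%:R ^+ 2 * (1141%:R/1000%:R - 40%:R * N%:R^-1))).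
    by rewrite sumr_const card_ffun card_ord -[X in _ <= X]mulr_natl natrX mulrCA.
  apply: ler_sum => r _; apply: pair_gain => //; first exact: nrank_lt.
  by move=> q; apply: tri.
have -> : \sum_(r : {ffun V -> 'I_N}) (matched e N (nrank r))%:R = \sum_v F v :> R.
  rewrite /F exchange_big; apply: eq_bigr => r _; rewrite /matched /pgain sum_gain //.
  by have sf := smatchP e_sym e_irr (nrank_lt r); apply: (stable_inv sf).
have S1 : \sum_(z | o z != z) F z <= \sum_v F v.
  by rewrite [X in _ <= X](bigID (fun z => o z != z)) /= lerDl; apply: sumr_ge0.
have S2 : \sum_(z | o z != z) F (o z) = \sum_(z | o z != z) F z.
  rewrite [RHS](reindex_inj (inv_inj oo)); apply: eq_bigl => z; by rewrite oo eq_sym.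
have S3 : \sum_(z | o z != z) N%:R ^+ #|V| * (1141%:R/1000%:R - 40%:R * N%:R^-1) <= \sum_(z | o z != z) (F z + F (o z)).
  by apply: ler_sum => z /oe; apply: pair.
have S4 : \sum_(z | o z != z) N%:R ^+ #|V| * (1141%:R/1000%:R - 40%:R * N%:R^-1) = (2 * mu)%:R * (N%:R ^+ #|V| * (1141%:R/1000%:R - 40%:R * N%:R^-1)) :> R.
  by rewrite -cardo [RHS]mulr_natl -sumr_const; apply: eq_bigl => z; rewrite inE.
move: S3; rewrite S4 big_split /= S2 natrM -!mulrA; lra.
Qed.

End TriangleFree.

(** * Expectations *)

Local Open Scope classical_set_scope.

(* No measurability is needed, the integral of a nonnegative function being a
   supremum over the simple functions below it. *)
Lemma ge0_le_integralT d (T : measurableType d) (R : realType)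
    (mu : {measure set T -> \bar R}) (f g : T -> \bar R) :
  (forall x, 0 <= f x)%E -> (forall x, f x <= g x)%E -> (\int[mu]_x f x <= \int[mu]_x g x)%E.
Proof.
move=> f0 fg; have g0 x : (0 <= g x)%E by apply: le_trans (f0 x) (fg x).
rewrite !ge0_integralTE //; apply: le_ereal_sup => _ [h hf <-]; exists h => // x.
exact: le_trans (hf x) (fg x).
Qed.

Lemma uniform_bucket (R : realType) N k : (k < N)%N ->
  uniform_prob (@ltr01 R) `[k%:R / N%:R, k.+1%:R / N%:R[%classic = (N%:R^-1)%:E.
Proof.
move=> kN; have N0 : 0 < N%:R :> R by rewrite ltr0n (leq_ltn_trans _ kN).
rewrite /uniform_prob (eq_integral (cst 1%E)); last first.
  move=> x /set_mem /=; rewrite in_itv /= => /andP[a b]; rewrite /uniform_pdf.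
  have -> : 0 <= x <= 1.
    rewrite (le_trans _ a) ?divr_ge0 //= (le_trans (ltW b)) //.
    by rewrite ler_pdivrMr // mul1r ler_nat.
  by rewrite subr0 invr1.
rewrite integral_cst //= mul1e lebesgue_measure_itv /= lte_fin ltr_pM2r ?invr_gt0 //.
by rewrite ltr_nat ltnSn -EFinB -mulrBl -natrB // subSnn mul1r.
Qed.

Lemma bucket_uniq (R : realType) N a b (x : R) : (0 < N)%N ->
  a%:R / N%:R <= x < a.+1%:R / N%:R -> b%:R / N%:R <= x < b.+1%:R / N%:R -> a = b.
Proof.
move=> N0 /andP[a1 a2] /andP[b1 b2].
have lt m m' : m%:R / N%:R <= x -> x < m'.+1%:R / N%:R -> (m <= m')%N.
  move=> h1 h2; have := le_lt_trans h1 h2.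
  by rewrite ltr_pM2r ?invr_gt0 ?ltr0n // ltr_nat ltnS.
by apply/eqP; rewrite eqn_leq !lt.
Qed.

(** With distinct grid cells the real ranks and the discrete ones order the vertices alike, so both
    sides describe the same unique stable matching. *)
Lemma ranking_cell (R : realType) (V : finType) (e : rel V) (x : V -> R) N (r : V -> nat) :
  symmetric e -> irreflexive e ->
  (forall v, (r v)%:R / N%:R <= x v < (r v).+1%:R / N%:R) -> injective r ->
  (forall v, (r v < N)%N) ->
  (2 * #|ranking e x|)%N = matched e N r.
Proof.
move=> es ei cellx rinj rN.
pose s := rank_order x.
have tot : total (fun u v => x u <= x v) by move=> a b; apply: le_total.
have tr : transitive (fun u v => x u <= x v) by move=> b a c; apply: le_trans.
have srt : sorted (fun u v => x u <= x v) s by apply: sort_sorted.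
have su : uniq s by rewrite sort_uniq enum_uniq.
have sa v : v \in s by rewrite mem_sort mem_enum.
have [f [sf E]] := greedy_stable es ei su sa.
have xlt a b : (r a < r b)%N -> x a < x b.
  move=> ab; have /andP[_ h1] := cellx a; have /andP[h2 _] := cellx b.
  apply: lt_le_trans h1 (le_trans _ h2).
  by rewrite ler_pM2r ?invr_gt0 ?ltr0n ?(leq_ltn_trans _ (rN a)) // ler_nat.
have idx a b : (index a s <= index b s)%N -> x a <= x b.
  exact: (sorted_leq_index tr (fun z => lexx _) srt).
have c2i a b : (crank r a <= crank r b)%N -> (index a s <= index b s)%N.
  rewrite crank_le => /orP[ab|/andP[/eqP/rinj -> _] //].
  by rewrite leqNgt; apply/negP => /ltnW/idx; rewrite leNgt xlt.
have i2c a b : (index a s <= index b s)%N -> (crank r a <= crank r b)%N.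
  move=> le; rewrite leqNgt; apply/negP => lt; have le2 := c2i _ _ (ltnW lt).
  have ii : index a s = index b s by apply/eqP; rewrite eqn_leq le le2.
  have E2 : a = b by rewrite -(nth_index a (sa a)) ii nth_index.
  by move: lt; rewrite E2 ltnn.
have cN v : (crank r v < N * vcard V)%N by rewrite crank_lt.
have sf2 : stable e (crank r) (N * vcard V) f.
  apply: stable_transfer sf => [v|//|a b]; first by rewrite index_mem.
  by apply/idP/idP; [apply: i2c|apply: c2i].
have ff := stable_uniq (@crank_inj _ r) cN es sf2 (smatchP es ei rN).
rewrite -[ranking e x]/(foldl (greedy_step e s) finset.set0 s) -E.
by apply: eq_card => v; rewrite !inE ff.
Qed.

Lemma cell_arith (R : realFieldType) (S I D q N : R) : 0 < q -> 0 < N ->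
  (S - I) * N <= D * q -> S / (2%:R * q) - D / (2%:R * N) <= I / 2%:R / q.
Proof.
move=> q0 N0 H; rewrite -subr_ge0.
have -> : I / 2%:R / q - (S / (2%:R * q) - D / (2%:R * N)) = (D * q - (S - I) * N) / (2%:R * q * N).
  by field; rewrite !gt_eqF.
by rewrite divr_ge0 ?subr_ge0 // !mulr_ge0 // ltW.
Qed.

Lemma ratio_arith (R : realFieldType) (m q N a C S D : R) : 0 < q -> 0 < N ->
  m * q * (a - C / N) <= S ->
  a / 2%:R * m - (C * m / 2%:R + D / 2%:R) / N <= S / (2%:R * q) - D / (2%:R * N).
Proof.
move=> q0 N0 H.
have -> : a / 2%:R * m - (C * m / 2%:R + D / 2%:R) / N = m * q * (a - C / N) / (2%:R * q) - D / (2%:R * N).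
  by field; rewrite !gt_eqF.
by rewrite lerD2r ler_wpM2r // invr_ge0 mulr_ge0 // ltW.
Qed.

(** * From grid averages to the expectation *)

Section Expectation.
Context (d : measure_display) (T : measurableType d) (R : realType).
Variables (P : probability T R) (V : finType) (X : V -> {RV P >-> R}) (e : rel V) (N : nat).
Hypotheses (iid : iid_uniform01 X) (e_sym : symmetric e) (e_irr : irreflexive e) (N0 : (0 < N)%N).

Definition cell (r : V -> nat) : set T := \bigcap_(v in [set` [set: V]%SET])
  (X v @^-1` `[(r v)%:R / N%:R, (r v).+1%:R / N%:R[%classic).

Lemma cellP r w : cell r w <-> forall v, (r v)%:R / N%:R <= X v w < (r v).+1%:R / N%:R.
Proof.
split=> [h v|h v _]; last by rewrite /= in_itv /=.
by have := h v; rewrite /= in_itv /=; apply; rewrite finset.in_setT.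
Qed.

Lemma measurable_cell r : measurable (cell r).
Proof.
apply: fin_bigcap_measurable => [|v _]; first exact: finite_finpred.
rewrite -[_ @^-1` _]classical_sets.setTI; apply: measurable_funP => //; exact: measurable_itv.
Qed.

Lemma cell_prob r : (forall v, (r v < N)%N) -> P (cell r) = (N%:R^-1 ^+ #|V|)%:E.
Proof.
case: iid => ind uni rN; rewrite /cell ind; last by move=> v; apply: measurable_itv.
rewrite (eq_bigr (fun=> (N%:R^-1)%:E)); last first.
  by move=> v _; rewrite -(uniform_bucket R (rN v)); apply: (uni v); apply: measurable_itv.
rewrite big_const finset.cardsT; elim: #|V| => [|m IH] /=; first by rewrite expr0.
by rewrite IH exprS EFinM.
Qed.

(** The matching size is bounded below by a function constant on the disjoint grid cells of
    injective rank vectors and zero elsewhere; each cell has probability [N^-1 ^+ #|V|]. *)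
Lemma expectation_ge_inj :
  (((\sum_(r : {ffun V -> 'I_N}) (injectiveb r)%:R * (matched e N (nrank r))%:R) / 2%:R / N%:R ^+ #|V|)%:E
   <= 'E_P[fun w => #|ranking e (fun v => X v w)|%:R])%E.
Proof.
rewrite expectation.unlock.
pose c (r : {ffun V -> 'I_N}) : R := (injectiveb r)%:R * (matched e N (nrank r))%:R / 2%:R.
have c0 r : 0 <= c r by rewrite /c !mulr_ge0.
pose g w : \bar R := (\sum_r (c r)%:E * (\1_(cell (nrank r)) w)%:E)%E.
have g0 w : (0 <= g w)%E.
  by apply: sume_ge0 => r _; rewrite -EFinM lee_fin mulr_ge0 // indicE.
apply: (@le_trans _ _ (\int[P]_w g w)%E); last first.
  apply: ge0_le_integralT => // w; rewrite /g.
  rewrite (eq_bigr (fun r => (c r * \1_(cell (nrank r)) w)%:E)) // sumEFin lee_fin.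
  have [[r0 h0]|no] := pselect (exists r : {ffun V -> 'I_N}, cell (nrank r) w); last first.
    rewrite big1 // => r _; rewrite indicE memNset ?mulr0 // => hr; by apply: no; exists r.
  rewrite (bigD1 r0) //= big1 ?addr0.
    rewrite indicE mem_set // mulr1 /c.
    case inj: (injectiveb r0); last by rewrite !mul0r.
    have rinj : injective (nrank r0) by move=> a b /val_inj; move/injectiveP: inj; apply.
    rewrite -(@ranking_cell R V e (fun v => X v w) N (nrank r0) e_sym e_irr _ rinj (nrank_lt r0)); last by apply/cellP.
    by rewrite mul1r natrM mulrAC divff ?mul1r // pnatr_eq0.
  move=> r rr; rewrite indicE memNset ?mulr0 // => hr; case/negP: rr; apply/eqP/ffunP => v; apply/val_inj.
  by apply: (bucket_uniq N0 ((cellP _ _).1 hr v) ((cellP _ _).1 h0 v)).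
rewrite ge0_integral_sum //; last 2 first.
- move=> r; apply: emeasurable_funM; first exact: measurable_cst.
  by apply/measurable_EFinP; apply: measurable_indic; apply: measurable_cell.
- by move=> r w _; rewrite -EFinM lee_fin mulr_ge0 // indicE.
rewrite (eq_bigr (fun r => (c r * N%:R^-1 ^+ #|V|)%:E)); last first.
  move=> r _; rewrite ge0_integralZl_EFin //; last first.
    by apply/measurable_EFinP; apply: measurable_indic; apply: measurable_cell.
  rewrite integral_indic ?classical_sets.setIT //; last exact: measurable_cell.
  by rewrite [RHS]EFinM; apply: (congr1 (fun p => (c r)%:E * p)%E); apply: cell_prob; apply: nrank_lt.
rewrite sumEFin lee_fin -mulr_suml exprVn ler_wpM2r ?invr_ge0 ?exprn_ge0 //.
by rewrite /c mulr_suml.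
Qed.

(** Counting the non-injective cells again changes the average by at most [#|V| / 2] on a share
    [#|V| ^ 2 / N] of the cells. *)
Lemma expectation_ge :
  (((\sum_(r : {ffun V -> 'I_N}) (matched e N (nrank r))%:R) / (2%:R * N%:R ^+ #|V|)
     - #|V|%:R ^+ 3 / (2%:R * N%:R))%:E <= 'E_P[fun w => #|ranking e (fun v => X v w)|%:R])%E.
Proof.
apply: le_trans expectation_ge_inj; rewrite lee_fin.
have NR : 0 < N%:R :> R by rewrite ltr0n.
have NV : 0 < N%:R ^+ #|V| :> R by rewrite exprn_gt0.
set S := \sum_r _; set I := \sum_r _.
have SI : S - I <= #|V|%:R * \sum_(r : {ffun V -> 'I_N}) (~~ injectiveb r)%:R.
  rewrite -sumrB mulr_sumr; apply: ler_sum => r _.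
  case: (injectiveb r) => /=; first by rewrite mul1r subrr mulr0.
  by rewrite mul0r subr0 mulr1 ler_nat max_card.
have nc := noninj_count R V N.
have : (S - I) * N%:R <= #|V|%:R ^+ 3 * N%:R ^+ #|V|.
  apply: le_trans (ler_wpM2r (ltW NR) SI) _.
  have := ler_wpM2l (ler0n R #|V|) nc; set q := N%:R ^+ #|_|; set Z := \sum_r _; lra.
exact: cell_arith.
Qed.

End Expectation.

Lemma limit_bound (R : realType) (E : \bar R) (a b C : R) : b < a -> 0 <= C ->
  (forall n, (0 < n)%N -> ((a - C / n.*2%:R)%:E <= E)%E) -> (b%:E <= E)%E.
Proof.
move=> ba C0 H; have ab : 0 < a - b by rewrite subr_gt0.
pose n := (Num.bound (C / (a - b))).+1.
apply: le_trans (H n isT); rewrite lee_fin lerBrDr -lerBrDl.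
have nR : 0 < n.*2%:R :> R by rewrite ltr0n double_gt0.
rewrite ler_pdivrMr // mulrC -ler_pdivrMr //.
apply: ltW; apply: lt_le_trans (archi_boundP _) _; first by rewrite divr_ge0 // ltW.
rewrite ler_nat /n; move: (Num.bound _) => m.
by rewrite -addnn; apply: leq_trans (leqnSn _) (leq_addr _ _).
Qed.

(** * Approximation ratios *)

Section Ratio.
Context (d : measure_display) (T : measurableType d) (R : realType).
Variables (P : probability T R) (V : finType) (X : V -> {RV P >-> R}) (e : rel V).
Hypotheses (iid : iid_uniform01 X) (e_graph : simple_graph e).
Let e_sym : symmetric e. Proof. by case: e_graph. Qed.
Let e_irr : irreflexive e. Proof. by case: e_graph. Qed.
Local Notation mu := (matching_number e).

Lemma ratio_of_average (a b C : R) : b < a / 2%:R -> 0 <= C ->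
  (forall n, (0 < n)%N -> mu%:R * n.*2%:R ^+ #|V| * (a - C / n.*2%:R) <=
     \sum_(r : {ffun V -> 'I_n.*2}) (matched e n.*2 (nrank r))%:R) ->
  ((b * mu%:R)%:E <= 'E_P[fun w => #|ranking e (fun v => X v w)|%:R])%E.
Proof.
(* The limit needs a strict gap after multiplication by [mu], so [mu = 0] is treated apart. The half
   in [a / 2] appears because [matched] counts vertices, not edges. *)
move=> ba C0 H; have [m0|m0] := posnP mu.
  by rewrite m0 mulr0; apply: expectation_ge0 => w.
apply: (@limit_bound _ _ (a / 2%:R * mu%:R) _ (C * mu%:R / 2%:R + #|V|%:R ^+ 3 / 2%:R)).
- by rewrite ltr_pM2r // ltr0n.
- by rewrite addr_ge0 ?divr_ge0 ?mulr_ge0 ?exprn_ge0.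
move=> n n0; have N0 : (0 < n.*2)%N by rewrite double_gt0.
apply: le_trans (expectation_ge iid e_sym e_irr N0); rewrite lee_fin.
have NR : 0 < n.*2%:R :> R by rewrite ltr0n.
have NV : 0 < n.*2%:R ^+ #|V| :> R by rewrite exprn_gt0.
exact: (ratio_arith _ NV NR (H n n0)).
Qed.

Lemma triangle_free_ratio : triangle_free e ->
  ((570%:R / 1000%:R * mu%:R)%:E <= 'E_P[fun w => #|ranking e (fun v => X v w)|%:R])%E.
Proof.
move=> tf.
have tri u w q : e u w -> e u q -> e q w -> False.
  move=> uw uq qw; apply: tf; exists [:: u; q; w] => //; split=> //.
  rewrite /ucycle /= uq qw e_sym uw /= !inE negb_or andbT.
  have neq a b : e a b -> a != b by move=> ab; apply/eqP => E; move: ab; rewrite E e_irr.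
  by rewrite !neq.
have [prt [oo oe cardo]] := max_matching_partner e_sym e_irr.
apply: (@ratio_of_average (1141%:R/1000%:R) _ 40%:R) => //; first by lra.
by move=> n n0; apply: (triangle_free_bound R n0 e_sym e_irr tri oo oe cardo).
Qed.

Lemma odd_girth_ratio : (129%:R%:E <= odd_girth R e)%E ->
  ((615%:R / 1000%:R * mu%:R)%:E <= 'E_P[fun w => #|ranking e (fun v => X v w)|%:R])%E.
Proof.
move=> og.
have girth (c : seq V) : (2 < size c)%N -> ucycle e c -> odd (size c) -> (129 <= size c)%N.
  move=> c2 uc oc; rewrite -(ler_nat R) -lee_fin; apply: le_trans og _.
  by apply: ereal_inf_lbound; exists c.
have [prt [oo oe cardo]] := max_matching_partner e_sym e_irr.
(* The factor 704/711 is the inverse of [1 + 7/704]. *)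
apply: (@ratio_of_average (2%:R * (704%:R/711%:R) * (83%:R/132%:R)) (615%:R/1000%:R) (2%:R * (704%:R/711%:R)));
  [by lra | by lra | move=> n n0].
have N0 : (0 < n.*2)%N by rewrite double_gt0.
have c0 : 0 <= 704%:R/711%:R :> R by lra.
have := ler_wpM2l c0 (odd_girth_bound R N0 e_sym e_irr girth oo oe cardo).
set S := \sum_r _; rewrite natrM.
have -> : 704%:R/711%:R * ((1 + 7%:R/704%:R) * S) = S by lra.
set q := n.*2%:R ^+ #|_|; set h := n.*2%:R^-1; lra.
Qed.
End Ratio.

Theorem theorem1p3 (R : realType) :
  ranking_achieves (562%:R / 1000%:R : R)
    (fun (V : finType) (e : rel V) => triangle_free e) /\
  ranking_achieves (570%:R / 1000%:R : R)
    (fun (V : finType) (e : rel V) => triangle_free e /\ pentagon_free e) /\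
  ranking_achieves (615%:R / 1000%:R : R)
    (fun (V : finType) (e : rel V) => (129%:R%:E <= odd_girth R e)%E).
Proof.
split; [|split] => V e eg _ cl d T P X iid.
(* The ratio 0.570 is proved for all triangle-free graphs, and 0.562 follows from it. *)
- apply: le_trans (triangle_free_ratio iid eg cl); rewrite lee_fin ler_wpM2r //; lra.
- by case: cl => tf _; apply: triangle_free_ratio.
- exact: odd_girth_ratio.
Qed.
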